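(* Let $\Omega\subset\mathbb{R}^n$ be a non-empty, bounded, open set and let $K\subset \mathbb{R}^m\times \mathbb{R}^m$ be compact. Let $\widehat K$ be the symmetrization and diagonalization of $K$, and let $\widehat K^{\rm sc}$ be the separately convex hull of $\widehat K$. If $m>1$, assume in addition that $\widehat K^{\rm sc}$ is compact and that $$\widehat{\widehat K^{\rm sc}}=\bigcup_{(\alpha,\beta)\in \widehat K} Q_{\alpha,\beta}\qquad\text{with}\qquad \mathcal P_{\widehat K^{\rm sc}}\subset\{Q_{\alpha,\beta}: (\alpha,\beta)\in\widehat K\}.$$ Then the (sequential) $L^\infty$-weak$^\ast$ closure of $\mathcal A_K$, that is, the set $$\{u\in L^\infty(\Omega;\mathbb{R}^m): \text{there is } (u_j)_j\subset\mathcal A_K \text{ with } u_j\rightharpoonup^\ast u \text{ in } L^\infty(\Omega;\mathbb{R}^m)\},$$ is equal to $\mathcal A_{\widehat K^{\rm sc}}$.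
   Context: For $E\subset\mathbb{R}^m\times\mathbb{R}^m$, $\mathcal A_E:=\{u\in L^\infty(\Omega;\mathbb{R}^m): (u(x),u(y))\in E \text{ for a.e. }(x,y)\in\Omega\times\Omega\}$ (a.e. with respect to Lebesgue measure). The symmetrization and diagonalization of $E$ is $\widehat E:=\{(\xi,\zeta)\in E: (\xi,\xi),(\zeta,\xi),(\zeta,\zeta)\in E\}$. A set $E\subset\mathbb{R}^m\times\mathbb{R}^m$ is separately convex (with vectorial components) if for all $t\in(0,1)$ and all $(\xi_1,\zeta_1),(\xi_2,\zeta_2)\in E$ with $\xi_1=\xi_2$ or $\zeta_1=\zeta_2$ one has $t(\xi_1,\zeta_1)+(1-t)(\xi_2,\zeta_2)\in E$. The separately convex hull $E^{\rm sc}$ is the smallest separately convex set in $\mathbb{R}^m\times\mathbb{R}^m$ containing $E$. The notation $\widehat K^{\rm sc}$ means $(\widehat K)^{\rm sc}$, and $\widehat{\widehat K^{\rm sc}}$ is the symmetrization and diagonalization of $(\widehat K)^{\rm sc}$. For $\alpha,\beta\in\mathbb{R}^m$, $[\alpha,\beta]:=\{t\alpha+(1-t)\beta: t\in[0,1]\}$ and $Q_{\alpha,\beta}:=[\alpha,\beta]\times[\alpha,\beta]$. A set $P\subset E$ is a maximal Cartesian subset of $E$ if $P=A\times A$ with $A\subset\mathbb{R}^m$ and if for any $B\subset\mathbb{R}^m$ with $A\subset B$ and $B\times B\subset E$ it holds that $B=A$. $\mathcal P_E$ denotes the set of all maximal Cartesian subsets of $E$. *)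

(* Defs.v *)
From HB Require Import structures.
From mathcomp Require Import all_boot all_order all_algebra.
From mathcomp Require Import all_classical all_reals all_analysis.
From mathcomp Require Import measurable_realfun.

Set Implicit Arguments.
Unset Strict Implicit.
Unset Printing Implicit Defensive.

Import Order.TTheory GRing.Theory Num.Theory.
Import numFieldNormedType.Exports.

Local Open Scope classical_set_scope.
Local Open Scope ring_scope.

Definition rV_display : measure_display.
Proof. exact. Qed.

Section measurable_rV.
Context (R : realType) (n : nat).

Definition rV_coord (i : 'I_n) (v : 'rV[R]_n) : measurableTypeR R := v ord0 i.

Let rV_set0 : g_sigma_preimage rV_coord set0.
Proof. exact: sigma_algebra0. Qed.

Let rV_setC A : g_sigma_preimage rV_coord A -> g_sigma_preimage rV_coord (~` A).
Proof. exact: sigma_algebraC. Qed.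

Let rV_bigcup (F : (set 'rV[R]_n)^nat) :
  (forall i, g_sigma_preimage rV_coord (F i)) ->
  g_sigma_preimage rV_coord (\bigcup_i (F i)).
Proof. exact: sigma_algebra_bigcup. Qed.

(* The sigma-algebra generated by the coordinates, as for [n.-tuple R]; it is
   the Borel one, see [measurable_rVE]. *)
HB.instance Definition _ := @isMeasurable.Build rV_display 'rV[R]_n
  (g_sigma_preimage rV_coord) rV_set0 rV_setC rV_bigcup.

Lemma measurable_rV_coord (i : 'I_n) : measurable_fun setT (rV_coord i).
Proof.
move=> _ Y mY; rewrite setTI; apply: sub_sigma_algebra.
by rewrite (bigD1 i)//=; left; exists Y => //; rewrite setTI.
Qed.

Lemma measurable_fun_rVP d (T : measurableType d) (f : T -> 'rV[R]_n) :
  (forall i, measurable_fun setT (rV_coord i \o f)) -> measurable_fun setT f.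
Proof.
move=> mf; apply: (measurability (\big[setU/set0]_(i < n)
  preimage_set_system setT (rV_coord i) measurable)) => //.
move=> _ [A BA <-].
have [i [B mB BE]] : exists i : 'I_n, exists2 B, measurable B &
    A = rV_coord i @^-1` B.
  elim/big_rec : _ BA => //= i X _ IH [[B mB <-]|/IH//].
  by exists i, B => //; rewrite setTI.
by rewrite BE; exact: (mf i).
Qed.

End measurable_rV.

Section lebesgue_rV.
Context (R : realType).

Definition rV_cons (n : nat) (p : measurableTypeR R * 'rV[R]_n) : 'rV[R]_n.+1 :=
  \row_i if unlift ord0 i is Some j then p.2 ord0 j else p.1.

Lemma rV_cons_ord0 n p : @rV_cons n p ord0 ord0 = p.1.
Proof. by rewrite mxE unlift_none. Qed.

Lemma rV_cons_lift n p (i : 'I_n) : @rV_cons n p ord0 (lift ord0 i) = p.2 ord0 i.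
Proof. by rewrite mxE liftK. Qed.

Lemma measurable_rV_cons n : measurable_fun setT (@rV_cons n).
Proof.
apply: measurable_fun_rVP => i; have [j|] := unliftP ord0 i => ->.
- rewrite (_ : _ \o _ = @rV_coord R n j \o snd); last first.
    by apply/funext => p; exact: rV_cons_lift.
  by apply: measurableT_comp => //; exact: measurable_rV_coord.
- rewrite (_ : _ \o _ = fst)//; last by apply/funext => p; exact: rV_cons_ord0.
Qed.

Definition rV_uncons (n : nat) (v : 'rV[R]_n.+1) :
    measurableTypeR R * 'rV[R]_n :=
  (v ord0 ord0, \row_j v ord0 (lift ord0 j)).

Lemma rV_unconsK n : cancel (@rV_uncons n) (@rV_cons n).
Proof.
move=> v; apply/rowP => i; have [j|] := unliftP ord0 i => ->.
- by rewrite rV_cons_lift mxE.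
- by rewrite rV_cons_ord0.
Qed.

Lemma rV_consK n : cancel (@rV_cons n) (@rV_uncons n).
Proof.
move=> [x v]; congr pair; first exact: rV_cons_ord0.
by apply/rowP => i; rewrite mxE rV_cons_lift.
Qed.

Lemma measurable_rV_uncons n : measurable_fun setT (@rV_uncons n).
Proof.
apply/measurable_fun_pairP; split; first exact: (@measurable_rV_coord R n.+1).
apply: measurable_fun_rVP => i.
rewrite (_ : _ \o _ = @rV_coord R n.+1 (lift ord0 i)).
  exact: measurable_rV_coord.
by apply/funext => v; rewrite /rV_coord/= mxE.
Qed.

Section lebesgue_rVS.
Context (n : nat) (mu : {sigma_finite_measure set 'rV[R]_n -> \bar R}).
Local Open Scope ereal_scope.

Definition lebesgue_rVS : set 'rV[R]_n.+1 -> \bar R :=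
  pushforward (@lebesgue_measure R \x mu) (@rV_cons n).

Let lebesgue_rVS0 : lebesgue_rVS set0 = 0.
Proof. by rewrite /lebesgue_rVS /pushforward preimage_set0 measure0. Qed.

Let lebesgue_rVS_ge0 A : 0 <= lebesgue_rVS A.
Proof. exact: (measure_ge0 (@lebesgue_measure R \x mu)). Qed.

Let lebesgue_rVS_sigma_additive : semi_sigma_additive lebesgue_rVS.
Proof.
move=> F mF tF mUF; rewrite /lebesgue_rVS /pushforward preimage_bigcup.
have mcons A : measurable A -> measurable (@rV_cons n @^-1` A).
  by move=> mA; rewrite -[X in measurable X]setTI; exact: measurable_rV_cons.
apply: measure_semi_sigma_additive.
- by move=> i; exact: mcons.
- apply/trivIsetP => /= i j _ _ ij; rewrite -preimage_setI.
  by move/trivIsetP : tF => /(_ _ _ _ _ ij) ->//; rewrite preimage_set0.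
- by rewrite -preimage_bigcup; exact: mcons.
Qed.

HB.instance Definition _ := isMeasure.Build _ _ _ lebesgue_rVS
  lebesgue_rVS0 lebesgue_rVS_ge0 lebesgue_rVS_sigma_additive.

Let lebesgue_rVS_sigma_finite : sigma_finite setT lebesgue_rVS.
Proof.
have /sigma_finiteP[F [TF ndF Foo]] := sigma_finiteT (@lebesgue_measure R).
have /sigma_finiteP[G [TG ndG Goo]] := sigma_finiteT mu.
exists (fun i => @rV_uncons n @^-1` (F i `*` G i)).
  apply/esym; rewrite -subTset => v _.
  have : [set: measurableTypeR R] (rV_uncons v).1 by [].
  have : [set: 'rV[R]_n] (rV_uncons v).2 by [].
  rewrite TF TG => -[j _ Gjv] [i _ Fiv]; exists (maxn i j) => //; split.
  - by move: Fiv; exact/subsetPset/ndF/leq_maxl.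
  - by move: Gjv; exact/subsetPset/ndG/leq_maxr.
move=> i; have [mF Fioo] := Foo i; have [mG Gioo] := Goo i; split.
  rewrite -[X in measurable X]setTI.
  by apply: measurable_rV_uncons => //; exact: measurableX.
rewrite /lebesgue_rVS /pushforward -comp_preimage.
rewrite (_ : _ \o _ = id); last by apply/funext; exact: rV_consK.
by rewrite preimage_id product_measure1E// lte_mul_pinfty// ge0_fin_numE.
Qed.

HB.instance Definition _ := Measure_isSigmaFinite.Build _ _ _ lebesgue_rVS
  lebesgue_rVS_sigma_finite.

End lebesgue_rVS.

(* n-dimensional Lebesgue measure, as the n-fold product of [lebesgue_measure];
   see [lebesgue_rV_box] for its values on boxes. *)
Fixpoint lebesgue_rV (n : nat) : {sigma_finite_measure set 'rV[R]_n -> \bar R} :=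
  match n with
  | 0 => \d_(0 : 'rV[R]_0)
  | n'.+1 => lebesgue_rVS (lebesgue_rV n')
  end.

Lemma measurable_rV_box (n : nat) (A : 'I_n -> set (measurableTypeR R)) :
  (forall i, measurable (A i)) ->
  measurable [set v : 'rV[R]_n | forall i, A i (v ord0 i)].
Proof.
move=> mA; rewrite (_ : mkset _ = \bigcap_i (@rV_coord R n i @^-1` A i)).
  apply: fin_bigcap_measurable => // i _; rewrite -[X in measurable X]setTI.
  exact: measurable_rV_coord.
by apply/seteqP; split=> [v Av i _|v Av i]; [exact: Av|exact: (Av i I)].
Qed.

Lemma lebesgue_rV_box (n : nat) (A : 'I_n -> set (measurableTypeR R)) :
  (forall i, measurable (A i)) ->
  lebesgue_rV n [set v | forall i, A i (v ord0 i)] =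
  (\prod_(i < n) lebesgue_measure (A i))%E.
Proof.
elim: n A => [|n IH] A mA.
  by rewrite big_ord0/= diracE mem_set// => -[].
rewrite big_ord_recl/= /lebesgue_rVS /pushforward.
have -> : @rV_cons n @^-1` [set v | forall i, A i (v ord0 i)] =
    A ord0 `*` [set v : 'rV[R]_n | forall i, A (lift ord0 i) (v ord0 i)].
  apply/seteqP; split=> [[x v] /= Av|[x v] /= [Ax Av] i].
  - split => [|i]; first by have := Av ord0; rewrite rV_cons_ord0.
    by have := Av (lift ord0 i); rewrite rV_cons_lift.
  - by have [j|] := unliftP ord0 i => ->; rewrite ?rV_cons_lift ?rV_cons_ord0.
rewrite product_measure1E//; first by congr (_ * _)%E; exact: IH.
exact: (@measurable_rV_box n (fun i => A (lift ord0 i))).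
Qed.

End lebesgue_rV.

Section borel_rV.
Context (R : realType) (n : nat).

Lemma open_measurable_rV (U : set 'rV[R]_n) : open U -> measurable U.
Proof.
move=> oU.
pose B (q : 'rV[rat]_n * nat) : set 'rV[R]_n :=
  [set v | forall i, ball (ratr (q.1 ord0 i) : R) q.2.+1%:R^-1 (v ord0 i)].
pose F q := if `[< B q `<=` U >] then B q else set0.
rewrite (_ : U = \bigcup_q F q).
  apply: countable_bigcupT_measurable => // q; rewrite /F; case: ifP => // _.
  apply: (@measurable_rV_box R n
    (fun i => ball (ratr (q.1 ord0 i) : R) q.2.+1%:R^-1)) => i.
  exact: measurable_ball.
apply/seteqP; split=> [v Uv|v [q _]]; last first.
  by rewrite /F; case: ifPn => // /asboolP qU /qU.
have /nbhs_ballP[e /= e0 veU] : nbhs v U by exact: open_nbhs_nbhs.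
have [k ke] : exists k, k.+1%:R^-1 < e / 2 :> R.
  have e20 : 0 < e / 2 by rewrite divr_gt0.
  by have [k _ /(_ k (leqnn k))] := near_infty_natSinv_lt (PosNum e20); exists k.
have /choice[q qv] : forall i, exists q : rat,
    ratr q \in `]v ord0 i, v ord0 i + k.+1%:R^-1[.
  by move=> i; apply: rat_in_itvoo; rewrite ltrDl invr_gt0.
have qvk i : `|ratr (q i) - v ord0 i| < k.+1%:R^-1.
  have := qv i; rewrite in_itv/= => /andP[vq qk].
  by rewrite gtr0_norm ?subr_gt0// ltrBlDl.
exists (\row_i q i, k) => //; rewrite /F ifT; last first.
  apply/asboolP => w /= Bw; apply: veU; split => // a i.
  have := Bw i; rewrite (ord1 a) mxE /ball/= => qw.
  rewrite [e]splitr (le_lt_trans (ler_distD (ratr (q i)) _ _))// ltrD//.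
  - by rewrite distrC; exact: lt_trans (qvk i) ke.
  - exact: lt_trans qw ke.
by move=> i /=; rewrite mxE; exact: qvk.
Qed.

Lemma measurable_rVE : @measurable _ 'rV[R]_n = <<s open >>.
Proof.
apply/seteqP; split; last first.
  apply: smallest_sub; last exact: open_measurable_rV.
  exact: sigma_algebra_measurable.
apply: smallest_sub; first exact: smallest_sigma_algebra.
move=> A; elim/big_rec : _ => //= i X _ IH [[B mB <-]|/IH//].
rewrite setTI.
have := mB; rewrite [measurable]RGenOpens.measurableE; move: B {mB}.
apply: smallest_sub.
- split=> [|C|C]; rewrite /= ?preimage_set0; first exact: sigma_algebra0.
  + by move=> mC; rewrite setTD preimage_setC; exact: sigma_algebraC.
  + by move=> mC; rewrite preimage_bigcup; exact: sigma_algebra_bigcup.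
- move=> _ [x [y ->]]; apply: sub_sigma_algebra.
  apply: open_comp; last exact: interval_open.
  by move=> v _; exact: coord_continuous.
Qed.

End borel_rV.

Section vector_Lp.
Context (R : realType) (n m : nat).
Implicit Types (Omega : set 'rV[R]_n) (u phi : 'rV[R]_n -> 'rV[R]_m).

(* Membership of (the class of) [u] in L^p(Omega; R^m).  Functions are total and
   Borel measurable on [Omega]; their values outside [Omega] are irrelevant.
   [`|u x|] is the max norm on R^m. *)
Definition Lp_vec Omega (p : \bar R) u : Prop :=
  measurable_fun Omega u /\
  (fun x => `|u x|) \_ Omega \in Lfun (lebesgue_rV R n) p.

Definition dot (a b : 'rV[R]_m) : R := \sum_(i < m) a ord0 i * b ord0 i.

(* Weak* convergence in L^oo(Omega; R^m), the dual of L^1(Omega; R^m). *)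
Definition weak_star_cvg Omega (u_ : ('rV[R]_n -> 'rV[R]_m)^nat) u : Prop :=
  forall phi, Lp_vec Omega 1%E phi ->
    \int[lebesgue_rV R n]_(x in Omega) dot (u_ j x) (phi x) @[j --> \oo] -->
    \int[lebesgue_rV R n]_(x in Omega) dot (u x) (phi x).

Definition admissible Omega (E : set ('rV[R]_m * 'rV[R]_m)) :
    set ('rV[R]_n -> 'rV[R]_m) :=
  [set u | Lp_vec Omega +oo%E u /\
    \forall z \ae (lebesgue_rV R n \x lebesgue_rV R n)%E,
      (Omega `*` Omega) z -> E (u z.1, u z.2)].

Definition weak_star_seq_closure Omega (S : set ('rV[R]_n -> 'rV[R]_m)) :
    set ('rV[R]_n -> 'rV[R]_m) :=
  [set u | Lp_vec Omega +oo%E u /\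
    exists u_ : ('rV[R]_n -> 'rV[R]_m)^nat,
      (forall j, S (u_ j)) /\ weak_star_cvg Omega u_ u].

End vector_Lp.

Section cartesian_sets.
Context (R : realType) (m : nat).
Implicit Types (E P : set ('rV[R]_m * 'rV[R]_m)) (A B : set 'rV[R]_m).

Definition symdiag E : set ('rV[R]_m * 'rV[R]_m) :=
  [set z | [/\ E z, E (z.1, z.1), E (z.2, z.1) & E (z.2, z.2)]].

Definition separately_convex E : Prop :=
  forall (t : R) (z w : 'rV[R]_m * 'rV[R]_m), 0 < t < 1 -> E z -> E w ->
    z.1 = w.1 \/ z.2 = w.2 -> E (t *: z + (1 - t) *: w).

Definition sc_hull E : set ('rV[R]_m * 'rV[R]_m) := smallest separately_convex E.

Definition segment (a b : 'rV[R]_m) : set 'rV[R]_m :=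
  [set t *: a + (1 - t) *: b | t in `[0, 1]%classic].

Definition square (a b : 'rV[R]_m) : set ('rV[R]_m * 'rV[R]_m) :=
  segment a b `*` segment a b.

Definition maximal_cartesian_subset E P : Prop :=
  P `<=` E /\ exists2 A, P = A `*` A &
    forall B, A `<=` B -> B `*` B `<=` E -> B = A.

Definition maximal_cartesian_subsets E : set (set ('rV[R]_m * 'rV[R]_m)) :=
  [set P | maximal_cartesian_subset E P].

End cartesian_sets.

(* Main.v *)
Require Import Defs.
From mathcomp Require Import all_boot all_order all_algebra.
From mathcomp Require Import all_classical all_reals all_analysis.
From mathcomp Require Import measurable_realfun ess_sup_inf ring lra.

Import Order.TTheory GRing.Theory Num.Theory.
Import numFieldNormedType.Exports HBSimple.

Local Open Scope classical_set_scope.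
Local Open Scope ring_scope.
Set Implicit Arguments.
Unset Strict Implicit.
Unset Printing Implicit Defensive.

(** The theorem reduces to functions with values in a single segment.

    Let [M] be the symmetrization and diagonalization of [K]. A function [u]
    satisfies the pointwise inclusion in a closed set [E] exactly when its
    essential range [A], a nonempty closed set, satisfies [A `*` A `<=` E]
    ([essential_range_cartesian]). The geometric input is that the separately
    convex hull of [M] is compact and that every nonempty closed [A] whose square
    lies in this hull is contained in a segment [[a, b]] with [(a, b)] in [M]
    ([sc_hull_compact_cartesian]). For [m > 1] the square over [A] extends, by
    Zorn's lemma, to a maximal Cartesian subset, which is the square over such a
    segment by assumption. For [m = 1] the hull is the union of the squares over
    the intervals [[a, b]] with [(a, b)] in [M], because this union is already
    separately convex; the segment is then found from the pair formed by the
    minimum and the maximum of [A]. Conversely the square over [[a, b]] is always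
    contained in the hull ([square_sub_sc_hull]).

    Weak limits: if [u_ j] is admissible for [K], it takes its values in a
    segment [[a_j, b_j]] with [(a_j, b_j)] in the compact set [M]. Let [(a, b)]
    be a cluster point of these pairs. A segment is an intersection of finitely
    many half-spaces with fixed normals [e] ([segment_half_spaces]), and testing
    the convergence against [e] times an indicator shows that the limit [u]
    satisfies each of these inequalities almost everywhere. Hence [u] takes its
    values in [[a, b]] ([weak_limit_segment]).

    Approximation: if [u] is admissible for the hull, then [u = b + lam (a - b)]
    with [(a, b)] in [M] and [0 <= lam <= 1]. Functions with values in [{a, b}]
    are admissible for [K], so it is enough to find sets [W j] whose indicators
    converge weakly to [lam]. As the measure of a bounded set cut by a moving
    hyperplane varies continuously ([lebesgue_rV_divisible]), [W j] can be chosen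
    to have the same mass as [lam] on each of the first [j] members of a
    countable pi-system generating the Borel sets. Dynkin's theorem and the
    density of simple functions do the rest
    ([exists_weakly_converging_indicators]). *)

(** * Segments, squares and the separately convex hull *)

Section segments.
Context (R : realType) (m : nat).
Implicit Types (a b x : 'rV[R]_m) (E : set ('rV[R]_m * 'rV[R]_m)).

Lemma segment_left a b : segment a b a.
Proof. by exists 1; rewrite ?subrr ?scale0r ?scale1r ?addr0//= in_itv/= ler01 lexx. Qed.

Lemma segment_right a b : segment a b b.
Proof. by exists 0; rewrite ?subr0 ?scale0r ?scale1r ?add0r//= in_itv/= ler01 lexx. Qed.

(** A separately convex set containing the four corners of a square contains
    the square: fill the two horizontal sides first, then every vertical line. *)
Lemma square_sub_separately_convex E a b : separately_convex E ->
  E (a, a) -> E (a, b) -> E (b, a) -> E (b, b) -> square a b `<=` E.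
Proof.
move=> scE Eaa Eab Eba Ebb.
have hor c x : E (a, c) -> E (b, c) -> segment a b x -> E (x, c).
  move=> Eac Ebc [t /=]; rewrite in_itv/= => /andP[].
  rewrite le_eqVlt => /predU1P[<- _ <-|t0].
    by rewrite subr0 scale0r scale1r add0r.
  rewrite le_eqVlt => /predU1P[-> <-|t1 <-].
    by rewrite subrr scale0r scale1r addr0.
  have := scE t _ _ _ Eac Ebc (or_intror erefl); rewrite t0 t1 => /(_ isT).
  by congr (E (_, _)); rewrite /= -scalerDl addrC subrK scale1r.
move=> [x y] /= [xab]; have Exa := hor _ _ Eaa Eba xab.
have Exb := hor _ _ Eab Ebb xab.
move=> [t /=]; rewrite in_itv/= => /andP[].
rewrite le_eqVlt => /predU1P[<- _ <-|t0].
  by rewrite subr0 scale0r scale1r add0r.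
rewrite le_eqVlt => /predU1P[-> <-|t1 <-].
  by rewrite subrr scale0r scale1r addr0.
have := scE t _ _ _ Exa Exb (or_introl erefl); rewrite t0 t1 => /(_ isT).
by congr (E (_, _)); rewrite /= -scalerDl addrC subrK scale1r.
Qed.

Lemma square_sub_sc_hull (K : set ('rV[R]_m * 'rV[R]_m)) a b :
  symdiag K (a, b) -> square a b `<=` sc_hull (symdiag K).
Proof.
move=> [] /= Kab Kaa Kba Kbb z sz E [scE KE].
by apply: (square_sub_separately_convex scE _ _ _ _ sz); apply: KE.
Qed.

Lemma symdiag_compact (K : set ('rV[R]_m * 'rV[R]_m)) :
  compact K -> compact (symdiag K).
Proof.
move=> cK; have clK : closed K by exact: (compact_closed (@norm_hausdorff _ _)).
have cfst : continuous (@fst 'rV[R]_m 'rV[R]_m) by move=> z; exact: cvg_fst.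
have csnd : continuous (@snd 'rV[R]_m 'rV[R]_m) by move=> z; exact: cvg_snd.
have -> : symdiag K = K `&` ((fun z => (z.1, z.1)) @^-1` K `&`
   ((fun z => (z.2, z.1)) @^-1` K `&` (fun z => (z.2, z.2)) @^-1` K)).
  by apply/seteqP; split=> [z []|z [? [? []]]].
apply: compact_closedI => //.
have pre (f g : 'rV[R]_m * 'rV[R]_m -> 'rV[R]_m) : continuous f ->
    continuous g -> closed ((fun z => (f z, g z)) @^-1` K).
  move=> cf cg; apply: (preimage_closed _ clK) => z _.
  by apply: (@cvg_pair _ _ _ _ (nbhs (f z)) (nbhs (g z))); [exact: cf|exact: cg].
apply: closedI; first exact: pre.
by apply: closedI; exact: pre.
Qed.

(** The union of the squares spanned by a compact set of pairs of endpoints. *)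
Lemma bigcup_square_compact (M : set ('rV[R]_m * 'rV[R]_m)) :
  compact M -> compact (\bigcup_(z in M) square z.1 z.2).
Proof.
move=> cM.
pose pt (t : R) (z : 'rV[R]_m * 'rV[R]_m) := t *: z.1 + (1 - t) *: z.2.
pose F (q : ('rV[R]_m * 'rV[R]_m) * (R * R)) := (pt q.2.1 q.1, pt q.2.2 q.1).
have -> : \bigcup_(z in M) square z.1 z.2 =
    F @` (M `*` (`[0, 1]%classic `*` `[0, 1]%classic)).
  apply/seteqP; split=> [w [z Mz [[s s01 sE] [t t01 tE]]]|].
    by exists (z, (s, t)) => //; rewrite /F/pt/= sE tE -surjective_pairing.
  move=> _ [[z [s t]] /= [Mz [s01 t01]] <-]; exists z => //.
  by split; [exists s|exists t].
apply: continuous_compact; last first.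
  by apply: compact_setX => //; apply: compact_setX; exact: segment_compact.
apply: continuous_subspaceT => q.
have cpt (h : (('rV[R]_m * 'rV[R]_m) * (R * R)) -> R) : continuous h ->
    (fun q => pt (h q) q.1) @ q --> pt (h q) q.1.
  move=> ch; apply: cvgD; apply: cvgZ.
  - exact: ch.
  - by apply: (@cvg_comp _ _ _ fst fst); [exact: cvg_fst|exact: cvg_fst].
  - by apply: cvgB; [exact: cvg_cst|exact: ch].
  - by apply: (@cvg_comp _ _ _ fst snd); [exact: cvg_fst|exact: cvg_snd].
by apply: (@cvg_pair _ _ _ _ (nbhs (pt q.2.1 q.1)) (nbhs (pt q.2.2 q.1)));
   apply: cpt => {}q;
   [apply: (@cvg_comp _ _ _ snd fst)|apply: (@cvg_comp _ _ _ snd snd)];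
   first [exact: cvg_fst|exact: cvg_snd].
Qed.

End segments.

Section line.
Context (R : realType).
Implicit Types (a b x : 'rV[R]_1) (M : set ('rV[R]_1 * 'rV[R]_1)).

Lemma segment_dim1 a b x : segment a b x <->
  (a ord0 ord0 <= x ord0 ord0 <= b ord0 ord0) ||
  (b ord0 ord0 <= x ord0 ord0 <= a ord0 ord0).
Proof.
split=> [[t /=]|].
  rewrite in_itv/= => /andP[t0 t1] <-; rewrite !mxE.
  have [ab|/ltW ba] := leP (a ord0 ord0) (b ord0 ord0).
    by apply/orP; left; apply/andP; split; nra.
  by apply/orP; right; apply/andP; split; nra.
move=> H; pose d := a ord0 ord0 - b ord0 ord0.
have [d0|d0] := eqVneq d 0.
  have -> : x = b.
    by apply/rowP => i; rewrite (ord1 i); move: H d0; rewrite /d; lra.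
  exact: segment_right.
exists ((x ord0 ord0 - b ord0 ord0) / d); last first.
  by apply/rowP => i; rewrite (ord1 i) !mxE; rewrite /d in d0 *; field.
rewrite /= in_itv/= -/d; have [dlt|dlt|d00] := ltgtP d 0.
- rewrite ler_ndivlMr// ler_ndivrMr// mul0r mul1r; move: H dlt; rewrite /d; lra.
- rewrite ler_pdivlMr// ler_pdivrMr// mul0r mul1r; move: H dlt; rewrite /d; lra.
- by rewrite d00 eqxx in d0.
Qed.

(** On the line, two points of the union with the same abscissa [u] lie in the
    squares over two intervals that both contain [u]; the union of these
    intervals is an interval, so every convex combination of the ordinates is in
    one of them. *)
Lemma separately_convex_bigcup_square M :
  separately_convex (\bigcup_(z in M) square z.1 z.2).
Proof.
move=> t [x1 y1] [x2 y2] t01 [[a1 b1] M1 /= [/= sx1 sy1]]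
  [[a2 b2] M2 /= [/= sx2 sy2]] xy.
have glue u p q : segment a1 b1 u -> segment a2 b2 u -> segment a1 b1 p ->
    segment a2 b2 q -> segment a1 b1 (t *: p + (1 - t) *: q) \/
    segment a2 b2 (t *: p + (1 - t) *: q).
  rewrite !segment_dim1 !mxE.
  move: (p ord0 ord0) (q ord0 ord0) (u ord0 ord0) (a1 ord0 ord0)
    (b1 ord0 ord0) (a2 ord0 ord0) (b2 ord0 ord0).
  move=> {M1 sx1 sy1 M2 sx2 sy2 xy}p {}q {}u {}a1 {}b1 {}a2 {}b2 u1 u2 p1 q2.
  set w := t * p + (1 - t) * q.
  have wpq : (p <= w <= q) || (q <= w <= p).
    have [pq|/ltW pq] := leP p q; rewrite /w; apply/orP; [left|right];
      by apply/andP; split; nra.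
  case/andP: t01 => _ _; clearbody w; apply/orP.
  by move: u1 u2 p1 q2 wpq; lra.
have same (p : 'rV[R]_1) : t *: p + (1 - t) *: p = p.
  by rewrite -scalerDl addrC subrK scale1r.
case: xy => /= xyE; subst.
- have [s|s] := glue _ _ _ sx1 sx2 sy1 sy2.
  + by exists (a1, b1) => //; split=> //=; rewrite same.
  + by exists (a2, b2) => //; split=> //=; rewrite same.
- have [s|s] := glue _ _ _ sy1 sy2 sx1 sx2.
  + by exists (a1, b1) => //; split=> //=; rewrite same.
  + by exists (a2, b2) => //; split=> //=; rewrite same.
Qed.

Lemma sc_hull_dim1 (K : set ('rV[R]_1 * 'rV[R]_1)) :
  sc_hull (symdiag K) = \bigcup_(z in symdiag K) square z.1 z.2.
Proof.
apply/seteqP; split.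
- apply: smallest_sub; first exact: separately_convex_bigcup_square.
  by move=> [a b] Kab; exists (a, b) => //; split;
    [exact: segment_left|exact: segment_right].
- by move=> z [[a b] Kab /(square_sub_sc_hull Kab)].
Qed.

(** The square over a compact set of reals is determined by the corner formed
    by its least and its greatest element. *)
Lemma cartesian_sub_segment_dim1 M (A : set 'rV[R]_1) :
  A !=set0 -> compact A -> A `*` A `<=` \bigcup_(z in M) square z.1 z.2 ->
  exists2 z, M z & A `<=` segment z.1 z.2.
Proof.
move=> A0 cA AM.
have cc : {within A, continuous (fun v : 'rV[R]_1 => v ord0 ord0)}.
  by apply: continuous_subspaceT => v; exact: coord_continuous.
have [p pA pmin] := EVT_min_rV A0 cA cc.
have [q qA qmax] := EVT_max_rV A0 cA cc.
move: pA qA; rewrite !inE => pA qA.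
have [[a b] Mab [/= pab qab]] := AM (p, q) (conj pA qA).
exists (a, b) => //= x Ax.
have := pmin x; have := qmax x; rewrite !inE => /(_ Ax) + /(_ Ax).
move: pab qab; rewrite !segment_dim1; lra.
Qed.

End line.

Section structure.
Context (R : realType) (m : nat).
Implicit Types (E : set ('rV[R]_m * 'rV[R]_m)) (A : set 'rV[R]_m).

(** Zorn's lemma, applied to the sets [X] such that the square over [A `|` X]
    lies in [E]. *)
Lemma maximal_cartesian_subset_exists E A : A `*` A `<=` E ->
  exists2 B, A `<=` B & maximal_cartesian_subset E (B `*` B).
Proof.
move=> AE; pose P X := (A `|` X) `*` (A `|` X) `<=` E.
have [|X [PX maxX]] := @Zorn_bigcup _ P.
  move=> F FP totF [x y] /= [[Ax|[X FX Xx]] [Ay|[Y FY Yy]]].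
  - exact: AE.
  - by apply: (FP _ FY); split; [left|right].
  - by apply: (FP _ FX); split; [right|left].
  - have [XY|YX] := totF _ _ FX FY.
    + by apply: (FP _ FY); split; right => //; exact: XY.
    + by apply: (FP _ FX); split; right => //; exact: YX.
exists (A `|` X); first exact: subsetUl.
split=> //; exists (A `|` X) => // B AXB BE.
have XB : X `<=` B by apply: subset_trans AXB; exact: subsetUr.
have AB : A `<=` B by apply: subset_trans AXB; exact: subsetUl.
apply/seteqP; split=> //; apply: contrapT => nBX.
apply: (maxX B).
  rewrite properEneq; split=> //; apply/eqP => XE; apply: nBX.
  by rewrite XE; exact: subsetUr.
by rewrite /P setUidr.
Qed.

(** The hull is compact, and every Cartesian square in it, over a nonempty closed
    set, lies in the square over a segment spanned by a pair of [symdiag K]: for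
    [m > 1] this comes from the assumptions, for [m = 1] it always holds. *)
Lemma sc_hull_compact_cartesian (K : set ('rV[R]_m * 'rV[R]_m)) :
  (0 < m)%N -> compact K ->
  ((1 < m)%N -> compact (sc_hull (symdiag K)) /\
    maximal_cartesian_subsets (sc_hull (symdiag K)) `<=`
      [set square z.1 z.2 | z in symdiag K]) ->
  compact (sc_hull (symdiag K)) /\
  forall A, A !=set0 -> closed A -> A `*` A `<=` sc_hull (symdiag K) ->
    exists2 z, symdiag K z & A `<=` segment z.1 z.2.
Proof.
move=> m0 cK; have [m1 _|m1 /(_ isT)[cH maxH]] := leqP m 1; last first.
  split=> // A A0 clA AH.
  have [B AB /maxH[[a b] Kab /= abB]] := maximal_cartesian_subset_exists AH.
  exists (a, b) => //= x Ax.
  have : (B `*` B) (x, x) by split; exact: AB.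
  by rewrite -abB => -[].
have mE : m = 1%N by apply/eqP; rewrite eqn_leq m1.
subst m; rewrite sc_hull_dim1; have cU := bigcup_square_compact (symdiag_compact cK).
split=> // A A0 clA AU; apply: (cartesian_sub_segment_dim1 A0 _ AU).
have -> : A = A `&` fst @` (\bigcup_(z in symdiag K) square z.1 z.2).
  by apply/esym/setIidPl => x Ax; exists (x, x) => //; exact: AU.
rewrite setIC; apply: compact_closedI => //; apply: continuous_compact => //.
by apply: continuous_subspaceT => z; exact: cvg_fst.
Qed.

End structure.

(** * Weak convergence to zero tested on a generating pi-system *)

Section weak_null.
Context d (T : measurableType d) (R : realType).
Context (mu : {measure set T -> \bar R}) (D : set T) (f : nat -> T -> R).
Hypothesis mD : measurable D.
Hypothesis muD : (mu D < +oo)%E.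
Hypothesis mf : forall j, measurable_fun D (f j).
Hypothesis f1 : forall j x, D x -> `|f j x| <= 1.
Implicit Types (phi psi : T -> R).

(** [phi] is an integrable function that [f j] annihilates in the limit. *)
Definition annihilated phi := mu.-integrable D (EFin \o phi) /\
  \int[mu]_(x in D) (f j x * phi x) @[j --> \oo] --> (0 : R).

Lemma integrable_bounded_mul j phi : mu.-integrable D (EFin \o phi) ->
  mu.-integrable D (EFin \o (fun x => f j x * phi x)).
Proof.
move=> iphi; apply: (le_integrable mD _ _ iphi).
  apply/measurable_EFinP; apply: measurable_funM => //.
  exact/measurable_EFinP/(measurable_int mu).
by move=> x Dx; rewrite /= lee_fin normrM ler_piMl// f1.
Qed.

Lemma annihilatedD phi psi : annihilated phi -> annihilated psi ->
  annihilated (fun x => phi x + psi x).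
Proof.
move=> [iphi phi0] [ipsi psi0]; split.
  have -> : EFin \o (fun x => phi x + psi x) = ((EFin \o phi) \+ (EFin \o psi))%E.
    by apply/funext => x; rewrite /= EFinD.
  exact: integrableD.
rewrite -[0]addr0; under eq_cvg => j.
  under eq_Rintegral => x _ do rewrite mulrDr.
  rewrite RintegralD//; [|exact: integrable_bounded_mul|exact: integrable_bounded_mul].
  over.
exact: cvgD.
Qed.

Lemma annihilatedZ (c : R) phi : annihilated phi ->
  annihilated (fun x => c * phi x).
Proof.
move=> [iphi phi0]; split.
  have -> : EFin \o (fun x => c * phi x) = (fun x => c%:E * (EFin \o phi) x)%E.
    by apply/funext => x; rewrite /= EFinM.
  exact: integrableZl.
rewrite -(mulr0 c); under eq_cvg => j.
  under eq_Rintegral => x _ do rewrite mulrCA.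
  rewrite RintegralZl//; last exact: integrable_bounded_mul.
  over.
by apply: cvgM => //; exact: cvg_cst.
Qed.

Lemma annihilated0 : annihilated (fun=> 0).
Proof.
split; first exact: integrable0.
under eq_cvg => j.
  under eq_Rintegral => x _ do rewrite mulr0.
  rewrite Rintegral_cst// mul0r.
  over.
exact: cvg_cst.
Qed.

Lemma annihilated_sum (I : Type) (s : seq I) (F : I -> T -> R) :
  (forall i, annihilated (F i)) -> annihilated (fun x => \sum_(i <- s) F i x).
Proof.
move=> aF; elim: s => [|i s IH].
  by under eq_fun do rewrite big_nil; exact: annihilated0.
by under eq_fun do rewrite big_cons; exact: annihilatedD.
Qed.

Lemma annihilated_L1_closed (psi : nat -> T -> R) phi :
  mu.-integrable D (EFin \o phi) -> (forall k, annihilated (psi k)) ->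
  (\int[mu]_(x in D) `|(psi k x)%:E - (phi x)%:E|)%E @[k --> \oo] --> 0%E ->
  annihilated phi.
Proof.
move=> iphi apsi /fine_cvgP[_ /cvgr0Pnorm_lt psi_phi]; split=> //.
apply/cvgr0Pnorm_lt => e e0; have e20 : 0 < e / 2 by rewrite divr_gt0.
have [k /= _ /(_ k (leqnn k)) kE] := psi_phi _ e20.
have [ipsi /cvgr0Pnorm_lt/(_ _ e20)] := apsi k.
apply: filterS => j jE.
have ipp : mu.-integrable D (EFin \o (fun x => phi x - psi k x)).
  have -> : EFin \o (fun x => phi x - psi k x) = ((EFin \o phi) \- (EFin \o psi k))%E.
    by apply/funext => x; rewrite /= EFinB.
  exact: integrableB.
have -> : \int[mu]_(x in D) (f j x * phi x) =
    \int[mu]_(x in D) (f j x * (phi x - psi k x)) +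
    \int[mu]_(x in D) (f j x * psi k x).
  rewrite -RintegralD//; [|exact: integrable_bounded_mul|exact: integrable_bounded_mul].
  by apply: eq_Rintegral => x _; rewrite -mulrDr subrK.
rewrite [e]splitr (le_lt_trans (ler_normD _ _))// ltrD//.
apply: le_lt_trans kE; rewrite (le_trans (le_normr_Rintegral _ _))//.
  exact: integrable_bounded_mul.
have ia : mu.-integrable D (EFin \o (fun x => `|phi x - psi k x|)).
  exact: (integrable_abse ipp).
apply: (@le_trans _ _ (\int[mu]_(x in D) `|phi x - psi k x|)).
  apply: le_Rintegral => //; first exact: (integrable_abse (integrable_bounded_mul j ipp)).
  by move=> x Dx; rewrite normrM ler_piMl// f1.
rewrite /= ger0_norm; last by apply: fine_ge0; exact: integral_ge0.
rewrite /Rintegral le_eqVlt; apply/orP; left; apply/eqP; congr fine.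
by apply: eq_integral => x _; rewrite /= distrC.
Qed.

Lemma integrable_indic_finite (A : set T) : measurable A ->
  mu.-integrable D (EFin \o \1_A).
Proof.
move=> mA; apply: (le_integrable mD (g := cst 1%E)).
- by apply/measurable_EFinP; exact: measurable_indic.
- by move=> x _; rewrite /= lee_fin normr1 ger0_norm ?ler_norml// indicE; case: (_ \in _).
- by apply/integrableP; split=> //; rewrite integral_cst//= ?normr1 mul1e.
Qed.

(** If [f j] annihilates the indicators of a pi-system generating the
    sigma-algebra, it annihilates all indicators (Dynkin), hence simple
    functions, hence, by density, all integrable functions. *)
Lemma annihilated_pi_system (G : set (set T)) :
  @measurable _ T = <<s G >> -> setI_closed G ->
  annihilated (cst 1) -> (forall A, G A -> annihilated \1_A) ->
  forall phi, mu.-integrable D (EFin \o phi) -> annihilated phi.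
Proof.
move=> GE GI a1 aG.
have aM : forall A, measurable A -> annihilated \1_A.
  rewrite GE; apply: (dynkin_induction GE GI) => //.
  - by rewrite indicT.
  - move=> A mA aA; have -> : \1_(~` A) = (fun x => 1 + -1 * \1_A x : R).
      apply/funext => x; rewrite !indicE in_setC.
      by case: (x \in A); rewrite /= ?mulr1 ?mulr0 ?subrr ?addr0.
    by apply: annihilatedD => //; exact: annihilatedZ.
  - move=> F mFn tF aF.
    have mU : measurable (\bigcup_k F k) by exact: bigcupT_measurable.
    (* The union is approximated in L^1 by its finite partial unions. *)
    pose psi k x := \sum_(0 <= i < k) \1_(F i) x : R.
    have psiE k : psi k = \1_(\bigcup_(i < k) F i).
      elim: k => [|k IH].
        by rewrite bigcup_mkord big_ord0 indic0; apply/funext => x; rewrite /psi big_nil.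
      apply/funext => x; rewrite /psi big_nat_recr//= -/(psi k x) IH.
      rewrite !indicE !bigcup_mkord big_ord_recr/= in_setU.
      have [xk|_] := boolP (x \in F k); last by rewrite addr0 orbF.
      rewrite (_ : x \in _ = false) ?add0r//; apply/negbTE/negP.
      rewrite -bigcup_mkord inE => -[i /= ik Fix]; rewrite inE in xk.
      by move: ik; rewrite (tF i k I I) ?ltnn//; exists x.
    apply: (@annihilated_L1_closed psi).
    + exact: integrable_indic_finite.
    + by move=> k; exact: annihilated_sum.
    + have mpsi k : measurable (\bigcup_(i < k) F i) by exact: bigcup_measurable.
      have [] := @dominated_convergence _ _ _ mu D mD (fun k => EFin \o psi k)
        (EFin \o \1_(\bigcup_k F k)) (cst 1%E).
      * by move=> k; rewrite psiE; apply/measurable_EFinP/measurable_indic.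
      * by apply/measurable_EFinP/measurable_indic.
      * apply: aeW => x _; apply: cvg_near_cst.
        have [[i _ Fi]|nF] := pselect ((\bigcup_k F k) x).
          exists i.+1 => // k /= ik; rewrite psiE /= !indicE !mem_set//.
          - by exists i.
          - by exists i.
        apply: nearW => k; rewrite psiE /= !indicE !memNset//.
        by move=> [i /= _ Fi]; apply: nF; exists i.
      * by apply/integrableP; split=> //; rewrite integral_cst//= ?normr1 mul1e.
      * by apply: aeW => x k _; rewrite psiE /= lee_fin ger0_norm indicE; case: (_ \in _).
      * by [].
move=> phi iphi; have [g [ig _ gphi]] := approximation_sfun_integrable mD iphi.
apply: (@annihilated_L1_closed (fun k => g k : T -> R)) => //.
- move=> k.
  have -> : (g k : T -> R) = (fun x => \sum_(y <- finmap.enum_fset (fset_set (range (g k))))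
      y * \1_(g k @^-1` [set y]) x).
    by apply/funext => x; rewrite fimfunE fsbig_finite.
  apply: annihilated_sum => y; apply: annihilatedZ; apply: aM.
  exact: measurable_sfunP.
- move: gphi; apply: cvg_trans; apply: near_eq_cvg.
  apply: nearW => k; apply: eq_integral => x _.
  by rewrite /= distrC.
Qed.

End weak_null.

(** * Indicators converging weakly to a given density *)

Section characteristic_functions.
Context d (T : measurableType d) (R : realType).
Context (mu : {measure set T -> \bar R}) (D : set T) (lam : T -> R).
Hypothesis mD : measurable D.
Hypothesis muD : (mu D < +oo)%E.
Hypothesis mlam : measurable_fun D lam.
Hypothesis lam01 : forall x, D x -> 0 <= lam x <= 1.
Hypothesis divisible : forall (B : set T) (c : R), measurable B -> B `<=` D ->
  0 <= c -> (c%:E <= mu B)%E ->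
  exists W, [/\ measurable W, W `<=` B & mu W = c%:E].

Lemma integrable_density : mu.-integrable D (EFin \o lam).
Proof.
apply: (le_integrable mD (g := cst 1%E)).
- exact/measurable_EFinP.
- by move=> x /lam01/andP[l0 l1]; rewrite /= lee_fin normr1 ger0_norm.
- by apply/integrableP; split=> //; rewrite integral_cst//= ?normr1 mul1e.
Qed.

(** A set [W] with the same mass as the density [lam] on [B] and on its
    intersections with finitely many given sets. *)
Lemma exists_subset_with_density (C : nat -> set T) (k : nat) (B : set T) :
  (forall i, measurable (C i)) -> measurable B -> B `<=` D ->
  exists W, [/\ measurable W, W `<=` B, mu W = \int[mu]_(x in B) (lam x)%:E &
    forall i, (i < k)%N -> mu (W `&` C i) = \int[mu]_(x in B `&` C i) (lam x)%:E]%E.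
Proof.
move=> mC; elim: k B => [|k IH] B mB BD.
  have il : mu.-integrable B (EFin \o lam).
    exact: (integrableS _ _ BD integrable_density).
  have [||W [mW WB muW]] := divisible mB BD (c := \int[mu]_(x in B) lam x).
  - by apply: Rintegral_ge0 => x /BD/lam01/andP[].
  - rewrite /Rintegral fineK ?integrable_fin_num//.
    have -> : mu B = (\int[mu]_(x in B) cst 1 x)%E by rewrite integral_cst// mul1e.
    apply: ge0_le_integral => //.
    + by move=> x /BD/lam01/andP[l0 _]; rewrite lee_fin.
    + exact: measurable_int il.
    + by move=> x /BD/lam01/andP[_ l1]; rewrite lee_fin.
  exists W; split=> //; rewrite muW /Rintegral fineK//.
  exact: integrable_fin_num.
(* Split along the last set and treat both halves separately. *)
have mBC : measurable (B `&` C k) by exact: measurableI.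
have mBD : measurable (B `\` C k) by exact: measurableD.
have [|W1 [mW1 W1B W1E W1C]] := IH (B `&` C k) mBC.
  by apply: subset_trans BD; exact: subIsetl.
have [|W2 [mW2 W2B W2E W2C]] := IH (B `\` C k) mBD.
  by apply: subset_trans BD; exact: subDsetl.
have W12 A : measurable A -> mu ((W1 `|` W2) `&` A) = (mu (W1 `&` A) + mu (W2 `&` A))%E.
  move=> mA; rewrite setIUl measureU//; [exact: measurableI|exact: measurableI|].
  by apply/seteqP; split=> // x [[/W1B[_ ?] _] [/W2B[]]].
have BE : (B `&` C k) `|` (B `\` C k) = B by rewrite setUC setDE -setIUr setUC setUv setIT.
have lamE A : measurable A -> (\int[mu]_(x in B `&` A) (lam x)%:E =
   \int[mu]_(x in (B `&` C k) `&` A) (lam x)%:E +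
    \int[mu]_(x in (B `\` C k) `&` A) (lam x)%:E)%E.
  move=> mA; rewrite -integral_setU_EFin//=.
  - by rewrite -setIUl BE.
  - exact: measurableI.
  - exact: measurableI.
  - rewrite -setIUl BE; apply: measurable_funS mlam => //.
    by apply: subset_trans BD; exact: subIsetl.
  - by apply/disj_setPS => x [[[_ ?] _] [[_ ?] _]].
exists (W1 `|` W2); split.
- exact: measurableU.
- by move=> x [/W1B[Bx _]|/W2B[Bx _]].
- have := lamE setT measurableT; rewrite !setIT => ->.
  by have := W12 setT measurableT; rewrite !setIT => ->; rewrite W1E W2E.
- move=> i; rewrite ltnS leq_eqVlt => /predU1P[->|ik]; last first.
    by rewrite W12// lamE// W1C// W2C.
  rewrite -W1E; congr (mu _); apply/seteqP; split=> [x [[//|/W2B[]//]]|x W1x].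
  by split; [left|have [] := W1B _ W1x].
Qed.

(** Every density [lam] with values in [0, 1] is the weak limit of indicators:
    prescribe the mass of the j-th set on the first j members of a countable
    generating pi-system. *)
Lemma exists_weakly_converging_indicators (C : nat -> set T) :
  @measurable _ T = <<s range C >> -> setI_closed (range C) ->
  exists W : nat -> set T, (forall j, measurable (W j)) /\
    forall phi : T -> R, mu.-integrable D (EFin \o phi) ->
      \int[mu]_(x in D) ((\1_(W j) x - lam x) * phi x) @[j --> \oo] --> (0 : R).
Proof.
move=> CE CI; have mC i : measurable (C i).
  by rewrite CE; apply: sub_sigma_algebra; exists i.
have /choice[W WP] := fun k => exists_subset_with_density k mC mD (@subset_refl _ D).
have mW j : measurable (W j) by have [] := WP j.
exists W; split=> // phi iphi.
pose f j x : R := \1_(W j) x - lam x.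
have iW j : mu.-integrable D (EFin \o \1_(W j)) by exact: integrable_indic_finite.
have mf j : measurable_fun D (f j).
  by apply: measurable_funB => //; exact: measurable_indic.
have f1 j x : D x -> `|f j x| <= 1.
  move=> /lam01; rewrite /f indicE; case: (_ \in _) => /= /andP[l0 l1];
    rewrite ler_norml; lra.
suff [] : annihilated mu D f phi by [].
have null A : measurable A ->
    (\forall j \near \oo, mu (W j `&` A) = \int[mu]_(x in D `&` A) (lam x)%:E)%E ->
    annihilated mu D f \1_A.
  move=> mA WA; split; first exact: integrable_indic_finite.
  apply: cvg_near_cst; apply: filterS WA => j jA.
  transitivity (\int[mu]_(x in D `&` A) f j x).
    rewrite Rintegral_mkcondr; apply: eq_Rintegral => x _.
    by rewrite patchE indicE; case: ifP; rewrite /= ?mulr1 ?mulr0.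
  have mDA : measurable (D `&` A) by exact: measurableI.
  have DAD : D `&` A `<=` D by exact: subIsetl.
  rewrite RintegralB//; [|exact: (integrableS mD)|exact: (integrableS mD _ _ integrable_density)].
  rewrite /Rintegral -jA integral_indic// setIA (_ : W j `&` D = W j) ?subrr//.
  by apply/setIidPl; have [] := WP j.
apply: (annihilated_pi_system mD muD mf f1 CE CI) iphi.
- rewrite -indicT; apply: null => //; apply: nearW => j.
  by rewrite !setIT; have [] := WP j.
- move=> _ [i _ <-]; apply: null => //; exists i.+1 => // j /= ij.
  by have [_ _ _ ->] := WP j.
Qed.

End characteristic_functions.

(** * Lebesgue measure on R^n *)

Section lebesgue_rV_facts.
Context (R : realType).

Lemma coord_le_norm (n : nat) (v : 'rV[R]_n) (i : 'I_n) : `|v ord0 i| <= `|v|.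
Proof.
rewrite [leRHS]mx_normrE.
exact: (le_bigmax _ (fun ij : 'I_1 * 'I_n => `|v ij.1 ij.2|) (ord0, i)).
Qed.

(** The open orthants, each made of the points whose coordinates all exceed
    those of some rational vector [q], form a countable pi-system generating
    the sigma-algebra. *)
Lemma countable_pi_system_rV (n : nat) : exists C : nat -> set 'rV[R]_n,
  @measurable _ 'rV[R]_n = <<s range C >> /\ setI_closed (range C).
Proof.
pose Q (q : 'rV[rat]_n) : set 'rV[R]_n := [set v | forall i, ratr (q ord0 i) < v ord0 i].
pose C k := Q (odflt 0 (unpickle k)).
have CQ q : C (pickle q) = Q q by rewrite /C pickleK.
exists C; split; last first.
  move=> _ _ [j _ <-] [k _ <-].
  exists (pickle (\row_i Order.max (odflt (0 : 'rV[rat]_n) (unpickle j) ord0 i)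
                 (odflt (0 : 'rV[rat]_n) (unpickle k) ord0 i))) => //.
  rewrite CQ /C; move: (odflt _ _) (odflt _ _) => p q.
  apply/seteqP; split=> [v Qv|v [Qp Qq] i /=].
    by split=> i; have := Qv i; rewrite mxE; apply: le_lt_trans;
      rewrite ler_rat le_max lexx ?orbT.
  by rewrite mxE maxElt; case: ifP => _; [exact: Qq|exact: Qp].
apply/seteqP; split; last first.
  apply: smallest_sub; first exact: sigma_algebra_measurable.
  move=> _ [k _ <-]; rewrite /C; move: (odflt _ _) => q.
  rewrite (_ : Q q = [set v | forall i, `]ratr (q ord0 i), +oo[%classic (v ord0 i)]).
    by apply: (@measurable_rV_box R n (fun i => `]ratr (q ord0 i), +oo[%classic)) => i;
      exact: measurable_itv.
  by apply/seteqP; split=> v Qv i; have := Qv i; rewrite /= in_itv/= andbT.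
apply: smallest_sub; first exact: smallest_sigma_algebra.
move=> A; elim/big_rec : _ => //= i X _ IH [[B mB <-]|/IH//].
rewrite setTI; have := mB; rewrite [measurable]RGenOInfty.measurableE; move: B {mB}.
apply: smallest_sub.
- split=> [|B|B]; rewrite /= ?preimage_set0; first exact: sigma_algebra0.
  + by move=> mB; rewrite setTD preimage_setC; exact: sigma_algebraC.
  + by move=> mB; rewrite preimage_bigcup; exact: sigma_algebra_bigcup.
- move=> _ [x ->].
  rewrite (_ : _ @^-1` _ =
      \bigcup_k (if `[< C k `<=` [set v | x < v ord0 i] >] then C k else set0)).
    apply: sigma_algebra_bigcup => k; case: ifP => _; last exact: sigma_algebra0.
    by apply: sub_sigma_algebra; exists k.
  apply/seteqP; split=> [v /=|v [k _]]; last first.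
    by case: ifP => // /asboolP Ck /Ck; rewrite /= in_itv/= andbT.
  rewrite in_itv/= andbT => xv.
  have /choice[q qv] : forall l, exists q : rat,
      ratr q \in `](if l == i then x else v ord0 l - 1), (v ord0 l)[.
    move=> l; apply: rat_in_itvoo; case: eqP => [->//|_].
    by rewrite ltrBlDr ltrDl.
  exists (pickle (\row_l q l)) => //; rewrite CQ ifT.
    by move=> l; rewrite mxE; have := qv l; rewrite in_itv/= => /andP[].
  apply/asboolP => w /(_ i); rewrite mxE; apply: lt_trans.
  by have := qv i; rewrite in_itv/= eqxx => /andP[].
Qed.

(** The mass of a bounded set [B] to the left of a hyperplane orthogonal to the
    first axis is a Lipschitz function of the position of the hyperplane, hence
    takes every value between 0 and the mass of [B]. *)
Lemma lebesgue_rV_divisible (n : nat) (D : set 'rV[R]_n) (B : set 'rV[R]_n)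
  (c : R) : (0 < n)%N -> bounded_set D -> measurable B -> B `<=` D ->
  0 <= c -> (c%:E <= lebesgue_rV R n B)%E ->
  exists W, [/\ measurable W, W `<=` B & lebesgue_rV R n W = c%:E].
Proof.
case: n D B => [//|n] D B _ /pinfty_ex_gt0[r r0 /= Dr] mB BD c0 cB.
pose mu := lebesgue_rV R n.+1.
pose H (s : R) := [set v : 'rV[R]_n.+1 | v ord0 ord0 < s].
pose S (s t : R) : set 'rV[R]_n.+1 :=
  [set v | forall i, (if i == ord0 then `[s, t[%classic else `[-r, r]%classic) (v ord0 i)].
have mH s : measurable (H s).
  rewrite (_ : H s = setT `&` @rV_coord R n.+1 ord0 @^-1` `]-oo, s[%classic).
    by apply: measurable_rV_coord => //; exact: measurable_itv.
  by apply/seteqP; split=> v; rewrite /H /rV_coord /= ?in_itv/=; tauto.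
have mS s t : measurable (S s t).
  apply: (@measurable_rV_box R n.+1
    (fun i => if i == ord0 then `[s, t[%classic else `[-r, r]%classic)) => i.
  by case: ifP => _; exact: measurable_itv.
have Bcoord v i : B v -> - r <= v ord0 i <= r.
  by move=> /BD/Dr vr; rewrite -ler_norml (le_trans (coord_le_norm _ _)).
have muS s t : s <= t -> mu (S s t) = ((t - s) * (2 * r) ^+ n)%:E.
  move=> st; rewrite /mu /S (@lebesgue_rV_box R n.+1
    (fun i => if i == ord0 then `[s, t[%classic else `[-r, r]%classic)); last first.
    by move=> i; case: ifP => _; exact: measurable_itv.
  rewrite big_ord_recl eqxx EFinM; congr (_ * _)%E.
    rewrite lebesgue_measure_itv/= lte_fin; case: ltP => // ts.
    by rewrite (@le_anti _ _ s t) ?subrr// st ts.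
  rewrite (eq_bigr (fun=> (2 * r)%:E)) => [|i _].
    by rewrite -(big_morph EFin (@EFinM R) erefl) prodr_const card_ord.
  rewrite lebesgue_measure_itv/= lte_fin ifT; last by rewrite gtrN.
  by rewrite -EFinD opprK mulr2n mulrDl mul1r.
have muB : mu B = mu (B `&` H (r + 1)).
  congr (mu _); apply/esym/setIidPl => v /Bcoord-/(_ ord0)/andP[_].
  by rewrite /H/=; lra.
have Hst s t : s <= t -> H s `<=` H t by move=> st v; rewrite /H/=; lra.
have step s t : s <= t -> (mu (B `&` H t) <= mu (B `&` H s) + ((t - s) * (2 * r) ^+ n)%:E)%E.
  move=> st; rewrite -muS//.
  apply: (@le_trans _ _ (mu ((B `&` H s) `|` S s t))).
    apply: le_measure; rewrite ?inE; [exact: measurableI| |].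
      by apply: measurableU => //; exact: measurableI.
    move=> v [Bv]; rewrite /H /= => vt; have [vs|vs] := ltP (v ord0 ord0) s; [by left|right].
    move=> i; case: eqP => [->|_] /=; first by rewrite in_itv/= vs.
    by rewrite in_itv/=; exact: Bcoord.
  by apply: measureU2 => //; exact: measurableI.
have fB s : mu (B `&` H s) \is a fin_num.
  rewrite ge0_fin_numE//; apply: (@le_lt_trans _ _ (mu (S (- r) (r + 1)))).
    apply: le_measure; rewrite ?inE//; first exact: measurableI.
    move=> v [Bv _] i; have /andP[? ?] := Bcoord v i Bv.
    by case: ifP => _; rewrite /= in_itv/=; lra.
  by rewrite muS ?ltry//; lra.
pose g s := fine (mu (B `&` H s)); pose L : R := (2 * r) ^+ n.
have L0 : 0 <= L by rewrite exprn_ge0// mulr_ge0// ltW.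
have gE s : mu (B `&` H s) = (g s)%:E by rewrite fineK.
have gmono s t : s <= t -> g s <= g t.
  move=> st; rewrite -lee_fin -!gE; apply: le_measure; rewrite ?inE; try exact: measurableI.
  by apply: setIS; exact: Hst.
have gstep s t : s <= t -> g t <= g s + (t - s) * L.
  by move=> /step; rewrite !gE -EFinD lee_fin.
have glip s t : `|g s - g t| <= `|s - t| * L.
  have [st|/ltW ts] := leP s t.
    have := gstep _ _ st; have := gmono _ _ st.
    by move: (g s) (g t) => a b *; rewrite !ler0_norm; lra.
  have := gstep _ _ ts; have := gmono _ _ ts.
  by move: (g s) (g t) => a b *; rewrite !ger0_norm; lra.
have cg : continuous g.
  move=> s; apply/cvgrPdist_lt => e e0.
  have eL : 0 < e / (L + 1) by rewrite divr_gt0// ltr_wpDl.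
  have [/(_ cvg_id) + _] := @cvgrPdist_lt _ _ _ (nbhs s) _ id s.
  move=> /(_ _ eL); apply: filterS => t st; apply: le_lt_trans (glip _ _) _.
  apply: (@le_lt_trans _ _ (`|s - t| * (L + 1))); first by rewrite ler_wpM2l// lerDl.
  rewrite -ltr_pdivlMr ?ltr_wpDl//.
have g0 : g (- r) = 0.
  rewrite /g (_ : _ `&` _ = set0) ?measure0//.
  apply/seteqP; split=> // v [/Bcoord-/(_ ord0)/andP[+ _]].
  by rewrite /H/=; lra.
have gB : mu B = (g (r + 1))%:E by rewrite muB gE.
have rr : - r <= r + 1 by lra.
have [|s _ gs] := IVT rr (continuous_subspaceT cg) (v := c).
  move: cB; rewrite -/mu gB lee_fin g0 => cg1.
  have g1 : 0 <= g (r + 1) by exact: le_trans cg1.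
  by rewrite min_l// max_r// c0.
exists (B `&` H s); split; [exact: measurableI|exact: subIsetl|].
by rewrite -/mu gE gs.
Qed.

Lemma lebesgue_rV_bounded_lty (n : nat) (D : set 'rV[R]_n) :
  bounded_set D -> measurable D -> (lebesgue_rV R n D < +oo)%E.
Proof.
move=> /pinfty_ex_gt0[r r0 /= Dr] mD.
have mI i : measurable ((fun _ : 'I_n => `[-r, r]%classic) i : set (measurableTypeR R)).
  exact: measurable_itv.
apply: (@le_lt_trans _ _ (lebesgue_rV R n [set v | forall i, `[-r, r]%classic (v ord0 i)])).
  apply: le_measure; rewrite ?inE//; first exact: (measurable_rV_box mI).
  move=> v /Dr vr i; rewrite /= in_itv/= -ler_norml.
  by rewrite (le_trans (coord_le_norm _ _)).
rewrite (lebesgue_rV_box mI) (eq_bigr (fun=> (r - - r)%:E)) => [|i _].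
  by rewrite -(big_morph EFin (@EFinM R) erefl) ltry.
by rewrite lebesgue_measure_itv/= lte_fin ifT// gtrN.
Qed.



End lebesgue_rV_facts.

Section product_ae.
Context d (T : measurableType d) (R : realType).
Context (mu : {sigma_finite_measure set T -> \bar R}).

Lemma ae_product (P : set T) : (\forall x \ae mu, P x) ->
  \forall z \ae (mu \x mu)%E, P z.1 /\ P z.2.
Proof.
move=> [N [mN N0 PN]]; have m1 : measurable (N `*` [set: T]) by exact: measurableX.
have m2 : measurable ([set: T] `*` N) by exact: measurableX.
have {}N0 : mu N = 0%E by exact: N0.
have N1 : (mu \x mu)%E (N `*` setT) = 0%E by
  rewrite (@product_measure1E _ _ _ _ _ mu mu)//= [X in (X * _)%E]N0 mul0e.
have N2 : (mu \x mu)%E (setT `*` N) = 0%E by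
  rewrite (@product_measure1E _ _ _ _ _ mu mu)//= [X in (_ * X)%E]N0 mule0.
exists (N `*` setT `|` setT `*` N); split; first exact: measurableU.
  by rewrite measureU0.
move=> z /= /not_andP[nP|nP]; [left|right]; split=> //; exact: PN.
Qed.

End product_ae.

Section vector_integrability.
Context (R : realType) (n m : nat) (Omega : set 'rV[R]_n).
Hypothesis mO : measurable Omega.
Notation mu := (lebesgue_rV R n).
Implicit Types (u v phi : 'rV[R]_n -> 'rV[R]_m) (a b c : 'rV[R]_m).

Lemma measurable_norm_rV (k : nat) :
  measurable_fun setT (fun v : 'rV[R]_k => `|v| : R).
Proof.
apply: (measurability _ (RGenOInfty.measurableE R)) => _ [_ [x ->] <-].
rewrite setTI; apply: open_measurable_rV.
by apply: open_comp; [move=> v _; exact: norm_continuous|exact: interval_open].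
Qed.

Lemma dotC a b : dot a b = dot b a.
Proof. by apply: eq_bigr => i _; rewrite mulrC. Qed.

Lemma dotDl a b c : dot (a + b) c = dot a c + dot b c.
Proof. by rewrite /dot -big_split; apply: eq_bigr => i _; rewrite !mxE mulrDl. Qed.

Lemma dotZl (t : R) a b : dot (t *: a) b = t * dot a b.
Proof. by rewrite /dot mulr_sumr; apply: eq_bigr => i _; rewrite !mxE mulrA. Qed.

Lemma Lp_vec_infty_intro v (M : R) : measurable_fun setT v ->
  (forall x, Omega x -> `|v x| <= M) -> Lp_vec Omega +oo%E v.
Proof.
move=> mv vM; split; first exact: measurable_funTS.
have M0 : 0 <= Num.max M 0 by rewrite le_max lexx orbT.
rewrite inE; apply/andP; split; rewrite inE/=.
  apply/(measurable_restrictT _ mO); apply: measurable_funTS.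
  exact: (measurableT_comp (@measurable_norm_rV m) mv).
rewrite /finite_norm unlock; case: ifP => _ //.
apply: (@le_lt_trans _ _ (Num.max M 0)%:E); last exact: ltry.
apply/ess_supP/aeW => x; rewrite /= lee_fin patchE; case: ifPn => [|_].
  by rewrite inE => /vM vx; rewrite normr_id le_max vx.
by rewrite normr0.
Qed.

Lemma Lp_vec1_intro v : measurable_fun Omega v ->
  mu.-integrable Omega (EFin \o (fun x => `|v x|)) -> Lp_vec Omega 1%E v.
Proof.
move=> mv iv; split=> //; apply/Lfun1_integrable.
by rewrite -restrict_EFin; apply/(integrable_mkcond _ mO).
Qed.

Lemma Lp_vec1_integrable v : Lp_vec Omega 1%E v ->
  mu.-integrable Omega (EFin \o (fun x => `|v x|)).
Proof.
move=> [_ /Lfun1_integrable]; rewrite -restrict_EFin.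
by move/(integrable_mkcond _ mO).
Qed.

Lemma Lp_vec_infty_integrable v : (mu Omega < +oo)%E ->
  Lp_vec Omega +oo%E v -> mu.-integrable Omega (EFin \o (fun x => `|v x|)).
Proof.
move=> Ooo [mv]; rewrite inE => /andP[_]; rewrite inE/= /finite_norm unlock.
have mnv : measurable_fun Omega (EFin \o (fun x => `|v x|)).
  by apply/measurable_EFinP; exact: (measurableT_comp (@measurable_norm_rV m) mv).
case: ifPn => [_ /ess_supr_bounded[M vM]|]; last first.
  rewrite -leNgt => muT _; apply/integrableP; split=> //.
  have O0 : mu Omega = 0%E.
    apply/eqP; rewrite eq_le measure_ge0 andbT (le_trans _ muT)//.
    by apply: le_measure; rewrite ?inE.
  by rewrite (integral_abs_eq0 mO mnv O0).
apply/integrableP; split=> //.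
apply: (@le_lt_trans _ _ (\int[mu]_(x in Omega) cst (Num.max M 0)%:E x)%E).
  apply: ae_ge0_le_integral => //.
  - exact: measurableT_comp.
  - by move=> x _; rewrite lee_fin le_max lexx orbT.
  - apply: filterS vM => x + Ox; rewrite /= lee_fin normr_id patchE mem_set// normr_id.
    by rewrite le_max => ->.
by rewrite integral_cst// lte_mul_pinfty// lee_fin le_max lexx orbT.
Qed.

Lemma integrable_dot v c : measurable_fun Omega v ->
  mu.-integrable Omega (EFin \o (fun x => `|v x|)) ->
  mu.-integrable Omega (EFin \o (fun x => dot (v x) c)).
Proof.
move=> mv iv.
have -> : EFin \o (fun x => dot (v x) c) =
    (fun x => \sum_(i < m) (c ord0 i)%:E * (EFin \o (fun x => v x ord0 i)) x)%E.
  apply/funext => x; rewrite /dot /= -sumEFin.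
  by apply: eq_bigr => i _; rewrite mulrC EFinM.
apply: integrable_sum => // i _; apply: integrableZl => //.
apply: (le_integrable mO _ _ iv).
  by apply/measurable_EFinP; exact: (measurableT_comp (@measurable_rV_coord R m i) mv).
by move=> x _; rewrite /= lee_fin normr_id coord_le_norm.
Qed.

End vector_integrability.

(** * Essential range *)

Section essential_range.
Context (R : realType).

Lemma rational_box_basis (k : nat) (U : set 'rV[R]_k) v : open U -> U v ->
  exists a b : 'rV[rat]_k,
    let box := [set w : 'rV[R]_k | forall i,
      `]ratr (a ord0 i), ratr (b ord0 i)[%classic (w ord0 i)] in
    box v /\ box `<=` U.
Proof.
move=> oU Uv; have /nbhs_ballP[e /= e0 veU] : nbhs v U by exact: open_nbhs_nbhs.
have /choice[a av] : forall i, exists q : rat, ratr q \in `](v ord0 i - e), (v ord0 i)[.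
  by move=> i; apply: rat_in_itvoo; rewrite ltrBlDr ltrDl.
have /choice[b bv] : forall i, exists q : rat, ratr q \in `](v ord0 i), (v ord0 i + e)[.
  by move=> i; apply: rat_in_itvoo; rewrite ltrDl.
have Hi i := (av i, bv i).
exists (\row_i a i), (\row_i b i); split=> [i|w wab].
  by rewrite !mxE /= in_itv/=; case: (Hi i); rewrite !in_itv/=; lra.
apply: veU; split => // i j; rewrite (ord1 i).
have := wab j; rewrite !mxE /= in_itv/= /ball/= ltr_norml.
by case: (Hi j); rewrite !in_itv/=; lra.
Qed.

Lemma lebesgue_rV_open_gt0 (n : nat) (U : set 'rV[R]_n) : open U -> U !=set0 ->
  (0 < lebesgue_rV R n U)%E.
Proof.
move=> oU [v Uv]; have [a [b /= [vab abU]]] := rational_box_basis oU Uv.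
pose I i : set (measurableTypeR R) := `]ratr (a ord0 i), ratr (b ord0 i)[%classic.
have mI i : measurable (I i) by exact: measurable_itv.
apply: (@lt_le_trans _ _ (lebesgue_rV R n [set w | forall i, I i (w ord0 i)])); last first.
  apply: le_measure; rewrite ?inE//; first exact: (measurable_rV_box mI).
  exact: open_measurable_rV.
rewrite (lebesgue_rV_box mI); apply: (@big_ind _ (fun x => 0 < x)%E) => //.
- by move=> x y; exact: mule_gt0.
- move=> i _; have := vab i; rewrite /= in_itv/= => /andP[av vb].
  rewrite lebesgue_measure_itv/= lte_fin ifT ?(lt_trans av)//.
  by rewrite -EFinD lte_fin subr_gt0 (lt_trans av).
Qed.

(** The essential range of [u]: the complement of the largest open set whose
    preimage is negligible. *)
Lemma essential_range_cartesian (n m : nat) (Omega : set 'rV[R]_n)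
    (u : 'rV[R]_n -> 'rV[R]_m) (E : set ('rV[R]_m * 'rV[R]_m)) :
  measurable Omega -> (0 < lebesgue_rV R n Omega)%E ->
  measurable_fun Omega u -> closed E ->
  (\forall z \ae (lebesgue_rV R n \x lebesgue_rV R n)%E,
      (Omega `*` Omega) z -> E (u z.1, u z.2)) ->
  exists A, [/\ A !=set0, closed A, A `*` A `<=` E &
    \forall x \ae lebesgue_rV R n, Omega x -> A (u x)].
Proof.
set mu := lebesgue_rV R n => mO O0 mu_ clE uE.
pose null (U : set 'rV[R]_m) := mu.-negligible (Omega `&` u @^-1` U).
pose A := ~` \bigcup_(U in [set U | open U /\ null U]) U.
have aeA : \forall x \ae mu, Omega x -> A (u x).
  pose box (p : 'rV[rat]_m * 'rV[rat]_m) := [set w : 'rV[R]_m | forall i,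
      `]ratr (p.1 ord0 i), ratr (p.2 ord0 i)[%classic (w ord0 i)].
  pose F k := if unpickle k is Some p then
    (if `[< null (box p) >] then Omega `&` u @^-1` box p else set0) else set0.
  apply: (@negligibleS _ _ _ _ (\bigcup_k F k)).
    move=> x /not_implyP[Ox /contrapT[U [oU nU] Uux]].
    have [a [b /= [vab abU]]] := rational_box_basis oU Uux.
    exists (pickle (a, b)) => //; rewrite /F pickleK ifT//.
    by apply/asboolP; apply: negligibleS nU => y [Oy yab]; split=> //; exact: abU.
  apply: negligible_bigcup => k; rewrite /F; case: unpickle => [p|]; last exact: negligible_set0.
  by case: ifPn => [/asboolP//|_]; exact: negligible_set0.
exists A; split=> //.
- apply: contrapT => A0; move: O0; rewrite lt_neqAle => /andP[/eqP + _]; apply.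
  apply/esym/negligibleP => //; apply: negligibleS aeA => x Ox /= Au.
  by apply: A0; exists (u x); exact: Au.
- by apply: open_closedC; apply: bigcup_open => U [].
- move=> [x y] [/= Ax Ay]; apply: contrapT => nE.
  have : nbhs (x, y) (~` E) by apply: open_nbhs_nbhs; split=> //; exact: closed_openC.
  move=> [[P Q] /= [nP nQ] PQ].
  (* If [(x, y)] were not in [E], a product of neighbourhoods would avoid [E],
     although its preimage has positive measure. *)
  have pos z P' : A z -> nbhs z P' ->
      (0 < mu (Omega `&` u @^-1` P'^°))%E /\ measurable (Omega `&` u @^-1` P'^°).
    move=> Az nP'; have mP : measurable (Omega `&` u @^-1` P'^°).
      by apply: mu_ => //; apply: open_measurable_rV; exact: open_interior.
    split=> //; rewrite lt_neqAle measure_ge0 andbT; apply/eqP => P0.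
    apply: Az; exists P'^°; last exact: nP'.
    by split; [exact: open_interior|exact/negligibleP].
  have [P0 mP] := pos _ _ Ax nP; have [Q0 mQ] := pos _ _ Ay nQ.
  have : (0 < (mu \x mu)%E ((Omega `&` u @^-1` P^°) `*` (Omega `&` u @^-1` Q^°)))%E.
    by rewrite (@product_measure1E _ _ _ _ _ mu mu)//= mule_gt0.
  rewrite lt_neqAle => /andP[/eqP + _]; apply; apply/esym/negligibleP.
    exact: measurableX.
  apply: negligibleS uE => -[s t] /= [[Os Ps] [Ot Qt]] /(_ (conj Os Ot)).
  by apply: (PQ (u s, u t)); split; exact: interior_subset.
Qed.

End essential_range.

(** * Segments as intersections of half-spaces *)

Section segment_support.
Context (R : realType) (m : nat).
Implicit Types (a b c x : 'rV[R]_m).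

Lemma dot_delta x (i : 'I_m) : dot x (delta_mx ord0 i) = x ord0 i.
Proof.
rewrite /dot (bigD1 i)//= mxE !eqxx mulr1 big1 ?addr0// => j ji.
by rewrite mxE (negbTE ji) andbF mulr0.
Qed.

Lemma dotNl a b : dot (- a) b = - dot a b.
Proof. by rewrite -scaleN1r dotZl mulN1r. Qed.

Lemma dotNr a b : dot a (- b) = - dot a b.
Proof. by rewrite dotC dotNl dotC. Qed.

Lemma dotBZr a b c (t : R) : dot a (b - t *: c) = dot a b - t * dot a c.
Proof. by rewrite dotC dotDl dotNl dotZl !(dotC _ a). Qed.

Lemma dot0l a : dot 0 a = 0.
Proof. by rewrite /dot big1// => i _; rewrite mxE mul0r. Qed.

Lemma dot_ge0 a : 0 <= dot a a.
Proof. by apply: sumr_ge0 => i _; rewrite -expr2 sqr_ge0. Qed.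

Lemma dot_eq0 a : dot a a = 0 -> a = 0.
Proof.
move=> /eqP; rewrite /dot psumr_eq0 => [/allP a0|i _]; last by rewrite -expr2 sqr_ge0.
apply/rowP => i; rewrite mxE; have := a0 i; rewrite mem_index_enum => /(_ isT) /=.
by rewrite mulf_eq0 orbb => /eqP.
Qed.

(** A segment is cut out by finitely many supporting half-spaces: those
    orthogonal to its direction [d] at its two ends, and those containing the
    line that carries it, with normals the projections of the coordinate
    vectors on the orthogonal complement of [d]. The normals are listed as a
    sequence that vanishes from some rank on. *)
Lemma segment_half_spaces a b : exists e : nat -> 'rV[R]_m, forall x,
  (forall k, dot x (e k) <= Num.max (dot a (e k)) (dot b (e k))) ->
  segment a b x.
Proof.
pose d := a - b; pose q := dot d d.
pose g i : 'rV[R]_m := delta_mx ord0 i - (d ord0 i / q) *: d.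
pose s := [:: d, - d & [seq g i | i <- enum 'I_m] ++ [seq - g i | i <- enum 'I_m]].
exists (nth 0 s) => x xs; pose w := x - b.
have ws e : e \in s -> dot w e <= Num.max (dot d e) 0.
  move=> /(nthP 0)[k _ <-]; have := xs k; set e' := nth _ _ _.
  rewrite /w /d !dotDl !dotNl le_max => xe.
  by rewrite le_max; apply/orP; case/orP: (xe); [left|right]; lra.
have q0 : 0 <= q by exact: dot_ge0.
have dg i : dot d (g i) = 0.
  have [q00|qn0] := eqVneq q 0.
    by rewrite (dot_eq0 q00) dot0l.
  by rewrite dotBZr dot_delta -/q divfK// subrr.
have gs i : (g i \in s) /\ (- g i \in s).
  by split; rewrite !inE mem_cat; do 2 (apply/orP; right); apply/orP; [left|right];
    apply: map_f; rewrite mem_enum.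
have wg i : dot w (g i) = 0.
  by have [/ws + /ws] := gs i; rewrite !dotNr dg oppr0 maxxx; lra.
pose t := dot w d / q.
have wE : w = t *: d.
  apply/rowP => i; have := wg i; rewrite dotBZr dot_delta.
  by move/eqP; rewrite subr_eq0 => /eqP ->; rewrite [RHS]mxE /t mulrC mulrA mulrAC.
exists t; last by rewrite scalerBl scale1r addrCA -scalerBr -/d -wE addrC subrK.
have := ws d; rewrite inE eqxx -/q max_l// => /(_ isT) wd.
have := ws (- d); rewrite !inE eqxx orbT !dotNr -/q => /(_ isT).
rewrite max_r ?oppr_le0// => wd0.
rewrite /= in_itv/= /t divr_ge0//=.
have [q00|qn0] := eqVneq q 0; first by rewrite q00 invr0 mulr0 ler01.
by rewrite ler_pdivrMr ?mul1r// lt_neqAle eq_sym qn0.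
Qed.

End segment_support.

(** * Weak limits and segments *)

Section weak_limits.
Context (R : realType) (n m : nat) (Omega : set 'rV[R]_n).
Hypothesis mO : measurable Omega.
Hypothesis Ooo : (lebesgue_rV R n Omega < +oo)%E.
Notation mu := (lebesgue_rV R n).
Implicit Types (u v phi : 'rV[R]_n -> 'rV[R]_m) (a b c e : 'rV[R]_m).

Lemma ae_le_Rintegral d (T : measurableType d) (nu : {measure set T -> \bar R})
  (D : set T) (f g : T -> R) : measurable D ->
  nu.-integrable D (EFin \o f) -> nu.-integrable D (EFin \o g) ->
  (\forall x \ae nu, D x -> f x <= g x) ->
  \int[nu]_(x in D) f x <= \int[nu]_(x in D) g x.
Proof.
move=> mD intf intg fg.
have mf : measurable_fun D f by exact/measurable_EFinP/(measurable_int nu).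
have mg : measurable_fun D g by exact/measurable_EFinP/(measurable_int nu).
have mfg : measurable_fun D (fun x => Num.min (f x) (g x)) by exact: measurable_minr.
have fgE : ae_eq nu D (EFin \o f) (EFin \o (fun x => Num.min (f x) (g x))).
  by apply: filterS fg => x fgx Dx; rewrite /= min_l// fgx.
have intm : nu.-integrable D (EFin \o (fun x => Num.min (f x) (g x))).
  apply: (le_integrable mD _ _ (integrableD mD (integrable_abse intf) (integrable_abse intg))).
    exact/measurable_EFinP.
  move=> x _; rewrite /= lee_fin [leRHS]ger0_norm ?addr_ge0//.
  by case: (leP (f x) (g x)) => _; rewrite ?lerDl ?lerDr.
apply: (@le_trans _ _ (\int[nu]_(x in D) Num.min (f x) (g x))).
  by rewrite /Rintegral (ae_eq_integral _ _ mD _ _ fgE)//; exact/measurable_EFinP.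
by apply: le_Rintegral => // x _; rewrite ge_min lexx orbT.
Qed.

Lemma Rintegral_dot_indic u e (N : set 'rV[R]_n) : N `<=` Omega ->
  \int[mu]_(x in Omega) dot (u x) (\1_N x *: e) = \int[mu]_(x in N) dot (u x) e.
Proof.
move=> NO; rewrite -{2}(setIidr NO) Rintegral_mkcondr; apply: eq_Rintegral => x _.
rewrite dotC dotZl dotC patchE indicE; case: ifP => _; rewrite ?mul1r ?mul0r//.
Qed.

(** Testing the weak limit against the normal [e] on the set where [u] leaves
    the half-space shows that this set is negligible. *)
Lemma weak_limit_half_space (u_ : nat -> 'rV[R]_n -> 'rV[R]_m) u
    (p_ : nat -> 'rV[R]_m * 'rV[R]_m) p e :
  (forall j, Lp_vec Omega +oo%E (u_ j)) -> Lp_vec Omega +oo%E u ->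
  (forall j, \forall x \ae mu, Omega x -> segment (p_ j).1 (p_ j).2 (u_ j x)) ->
  cluster (p_ @ \oo) p -> weak_star_cvg Omega u_ u ->
  \forall x \ae mu, Omega x -> dot (u x) e <= Num.max (dot p.1 e) (dot p.2 e).
Proof.
move=> Lu_ Lu u_p clp wu.
pose h (z : 'rV[R]_m * 'rV[R]_m) := Num.max (dot z.1 e) (dot z.2 e).
have mdot v : measurable_fun Omega v -> measurable_fun Omega (fun x => dot (v x) e).
  move=> mv; apply: measurable_sum => i; apply: measurable_funM => //.
  exact: (measurableT_comp (@measurable_rV_coord R m i) mv).
pose N := Omega `&` (fun x => dot (u x) e) @^-1` `]h p, +oo[.
have mN : measurable N by apply: (mdot _ Lu.1) => //; exact: measurable_itv.
have NO : N `<=` Omega by exact: subIsetl.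
have Noo : (mu N < +oo)%E by apply: le_lt_trans Ooo; apply: le_measure; rewrite ?inE.
have int v : Lp_vec Omega +oo%E v -> mu.-integrable N (EFin \o (fun x => dot (v x) e)).
  move=> Lv; apply: (integrableS mO mN NO).
  apply: (integrable_dot mO); first exact: Lv.1.
  exact: Lp_vec_infty_integrable.
have icst (c : R) : mu.-integrable N (EFin \o cst c).
  apply/integrableP; split; first exact/measurable_EFinP.
  by rewrite (integral_cst mu mN `|c|%:E) lte_mul_pinfty// lee_fin.
(* The integral over [N] of the j-th function is at most [h (p_ j)] times the
   mass of [N]; this bound passes to the limit along the cluster point [p],
   whereas the integrand of the limit exceeds [h p] on [N]. *)
have up j : \int[mu]_(x in N) dot (u_ j x) e <= h (p_ j) * fine (mu N).
  rewrite -Rintegral_cst//; apply: ae_le_Rintegral => //; [exact: int|exact: icst|].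
  apply: filterS (u_p j) => x + /NO Ox => /(_ Ox) [t].
  rewrite /= in_itv/= => /andP[t0 t1] <-; rewrite dotDl !dotZl /h.
  by have [le|le] := leP (dot (p_ j).1 e) (dot (p_ j).2 e); nra.
have ucvg : \int[mu]_(x in N) dot (u_ j x) e @[j --> \oo] --> \int[mu]_(x in N) dot (u x) e.
  rewrite -(Rintegral_dot_indic _ _ NO); under eq_cvg do rewrite -(Rintegral_dot_indic _ _ NO).
  apply: wu; apply: Lp_vec1_intro => //.
  - apply: measurable_funTS; apply: measurable_fun_rVP => i.
    rewrite (_ : _ \o _ = fun x => \1_N x * e ord0 i); last first.
      by apply/funext => x; rewrite /rV_coord/= mxE.
    by apply: measurable_funM => //; exact: measurable_indic.
  - have -> : EFin \o (fun x => `|\1_N x *: e|) = (fun x => `|e|%:E * (EFin \o \1_N) x)%E.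
      by apply/funext => x /=; rewrite normrZ !indicE normr_nat mulrC EFinM.
    by apply: integrableZl => //; exact: integrable_indic_finite.
have cdot : continuous (fun x : 'rV[R]_m => dot x e).
  apply: continuous_big => [|i _ x]; first exact: add_continuous.
  by apply: continuousM; [exact: coord_continuous|exact: cst_continuous].
have ch : continuous h.
  apply: (@max_fun_continuous _ _ R (fun z => dot z.1 e) (fun z => dot z.2 e)) => z.
  - by apply: (@continuous_comp _ _ _ fst (fun x => dot x e)); [exact: cvg_fst|exact: cdot].
  - by apply: (@continuous_comp _ _ _ snd (fun x => dot x e)); [exact: cvg_snd|exact: cdot].
have uh : \int[mu]_(x in N) dot (u x) e <= h p * fine (mu N).
  apply/ler_addgt0Pr => eps eps0.
  have M0 : 0 <= fine (mu N) by exact: fine_ge0.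
  have e20 : 0 < eps / 2 by rewrite divr_gt0.
  have d0 : 0 < eps / 2 / (fine (mu N) + 1) by rewrite divr_gt0// ltr_wpDl.
  have /cvgrPdist_lt/(_ _ e20)[J _ HJ] := ucvg.
  have [_ [[j Jj <-] hj]] : [set p_ j | j in [set j | (J <= j)%N]] `&`
      [set z | `|h p - h z| < eps / 2 / (fine (mu N) + 1)] !=set0.
    apply: clp; first by exists J => // j Jj; exists j.
    by move: d0; move/cvgrPdist_lt : (ch p); apply.
  have := HJ _ Jj; have := up j; move: hj; rewrite /= ltr_pdivlMr ?ltr_wpDl//.
  move: (h p) (h (p_ j)) => hp hj; rewrite !ltr_norml => H1 H2 /andP[_ H3].
  have : (hj - hp) * (fine (mu N) + 1) < eps / 2.
    have H0 : hj - hp <= `|hp - hj| by rewrite distrC ler_norm.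
    by apply: le_lt_trans H1; apply: ler_wpM2r H0; rewrite addr_ge0.
  have [hjp|/ltW hjp] := leP hj hp; nra.
have fint := int _ Lu.
have dint : mu.-integrable N (EFin \o (fun x => dot (u x) e - h p)).
  have -> : EFin \o (fun x => dot (u x) e - h p) =
     ((EFin \o (fun x => dot (u x) e)) \- (EFin \o cst (h p)))%E.
    by apply/funext => x; rewrite /= EFinB.
  exact: integrableB.
have N0 : mu.-negligible N.
  have : (\int[mu]_(x in N) `|(EFin \o (fun x => dot (u x) e - h p)%R) x|)%E = 0%E.
    have -> : (\int[mu]_(x in N) `|(EFin \o (fun x => dot (u x) e - h p)%R) x| =
       \int[mu]_(x in N) (dot (u x) e - h p)%R%:E)%E.
      apply: eq_integral => x; rewrite inE => -[_ /=]; rewrite in_itv/= andbT => xh.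
      by rewrite ger0_norm// subr_ge0 ltW.
    apply/eqP; rewrite -[X in X == _]fineK ?integrable_fin_num// eqe.
    rewrite -/(Rintegral mu N (fun x => dot (u x) e - h p)).
    rewrite eq_le; apply/andP; split.
      rewrite RintegralB// ?icst// Rintegral_cst// subr_le0//.
    apply: Rintegral_ge0 => x [_ /=]; rewrite in_itv/= andbT => xh.
    by rewrite subr_ge0 ltW.
  move/(ae_eq_integral_abs mu mN (measurable_int _ dint)).
  apply: negligibleS => x Nx /= /(_ Nx); case: Nx => _ /=; rewrite in_itv/= andbT => + [].
  by move=> /[swap] /eqP; rewrite subr_eq0 => /eqP ->; rewrite ltxx.
apply: negligibleS N0 => x /= /not_implyP[Ox /negP]; rewrite -ltNge => xh.
by split=> //=; rewrite in_itv/= andbT.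
Qed.

Lemma weak_limit_segment (u_ : nat -> 'rV[R]_n -> 'rV[R]_m) u
    (p_ : nat -> 'rV[R]_m * 'rV[R]_m) p :
  (forall j, Lp_vec Omega +oo%E (u_ j)) -> Lp_vec Omega +oo%E u ->
  (forall j, \forall x \ae mu, Omega x -> segment (p_ j).1 (p_ j).2 (u_ j x)) ->
  cluster (p_ @ \oo) p -> weak_star_cvg Omega u_ u ->
  \forall x \ae mu, Omega x -> segment p.1 p.2 (u x).
Proof.
move=> Lu_ Lu u_p clp wu; have [e eP] := segment_half_spaces p.1 p.2.
have /ae_foralln : forall k, \forall x \ae mu, Omega x ->
    dot (u x) (e k) <= Num.max (dot p.1 (e k)) (dot p.2 (e k)).
  by move=> k; exact: weak_limit_half_space u_p clp wu.
by apply: filterS => x H Ox; apply: eP => k; exact: H.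
Qed.

(** Every function with values in a segment is a weak limit of functions
    taking only the two end points as values. *)
Lemma segment_weak_limit a b u : (0 < n)%N -> bounded_set Omega ->
  Lp_vec Omega +oo%E u ->
  (\forall x \ae mu, Omega x -> segment a b (u x)) ->
  exists u_ : nat -> 'rV[R]_n -> 'rV[R]_m,
    [/\ forall j, Lp_vec Omega +oo%E (u_ j),
        forall j x, u_ j x = a \/ u_ j x = b & weak_star_cvg Omega u_ u].
Proof.
move=> n0 bO Lu uab; pose d := a - b.
(* The barycentric coordinate of [u x] on the segment, truncated so as to lie in
   [0, 1] everywhere; it is zero when the segment is a point. *)
pose lam x : R := Num.max 0 (Num.min 1 (dot (u x - b) d / dot d d)).
have mdot v c : measurable_fun Omega v -> measurable_fun Omega (fun x => dot (v x) c).
  move=> mv; apply: measurable_sum => i; apply: measurable_funM => //.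
  exact: (measurableT_comp (@measurable_rV_coord R m i) mv).
have mlam : measurable_fun Omega lam.
  apply: measurable_maxr => //; apply: measurable_minr => //.
  apply: measurable_funM => //.
  under eq_fun do rewrite dotDl.
  by apply: measurable_funD => //; apply: mdot; exact: Lu.1.
have lam01 x : Omega x -> 0 <= lam x <= 1.
  by move=> _; rewrite /lam le_max lexx/= ge_max ler01 ge_min lexx.
have ulam : \forall x \ae mu, Omega x -> u x = b + lam x *: d.
  apply: filterS uab => x H Ox; have [t /= + utE] := H Ox.
  rewrite in_itv/= => /andP[t0 t1].
  have ubd : u x - b = t *: d.
    by rewrite -utE; apply/rowP => i; rewrite !mxE; ring.
  rewrite /lam ubd dotZl; have [q0|q0] := eqVneq (dot d d) 0.
    have d0 := dot_eq0 q0; rewrite d0 scaler0 addr0.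
    by move/eqP: ubd; rewrite d0 scaler0 subr_eq0 => /eqP.
  by rewrite mulfK// min_r// max_r// -ubd addrC subrK.
have [C [CE CI]] := countable_pi_system_rV R n.
have [W [mW WP]] := exists_weakly_converging_indicators mO Ooo mlam lam01
  (fun B r mB BD => lebesgue_rV_divisible n0 bO mB BD) CE CI.
pose u_ j x : 'rV[R]_m := b + (\1_(W j) x : R) *: d.
have u_ab j x : u_ j x = a \/ u_ j x = b.
  rewrite /u_ indicE; case: (_ \in _); rewrite ?scale1r ?scale0r ?addr0 /d.
    by left; rewrite addrC subrK.
  by right.
have mu_ j : measurable_fun setT (u_ j).
  apply: measurable_fun_rVP => i.
  rewrite (_ : _ \o _ = fun x => b ord0 i + (\1_(W j) x : R) * d ord0 i); last first.
    by apply/funext => x; rewrite /rV_coord/= !mxE.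
  by apply: measurable_funD => //; apply: measurable_funM => //; exact: measurable_indic.
exists u_; split=> //.
  move=> j; apply: (Lp_vec_infty_intro mO (M := Num.max `|a| `|b|)) => // x _.
  by rewrite le_max; apply/orP; case: (u_ab j x) => ->; [left|right].
move=> phi Lphi.
have iphi c : mu.-integrable Omega (EFin \o (fun x => dot (phi x) c)).
  by apply: (integrable_dot mO); [exact: Lphi.1|exact: Lp_vec1_integrable].
have bounded_mul (f : 'rV[R]_n -> R) : measurable_fun Omega f ->
    (forall x, Omega x -> 0 <= f x <= 1) ->
    mu.-integrable Omega (EFin \o (fun x => f x * dot (phi x) d)).
  move=> mf f01; apply: (@integrable_bounded_mul _ _ _ mu Omega (fun=> f) mO _ _ 0%N) => //.
  by move=> _ x /f01/andP[f0 f1]; rewrite ger0_norm.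
have iW j : mu.-integrable Omega (EFin \o (fun x => (\1_(W j) x - lam x) * dot (phi x) d)).
  have -> : EFin \o (fun x => (\1_(W j) x - lam x) * dot (phi x) d) =
    ((EFin \o (fun x => \1_(W j) x * dot (phi x) d)%R) \-
     (EFin \o (fun x => lam x * dot (phi x) d)%R))%E.
    by apply/funext => x; rewrite /= mulrBl EFinB.
  apply: integrableB => //; last exact: bounded_mul.
  apply: bounded_mul; first exact: measurable_indic.
  by move=> x _; rewrite indicE; case: (_ \in _); rewrite ?lexx ?ler01.
have ilam : mu.-integrable Omega (EFin \o (fun x => dot (b + lam x *: d) (phi x))).
  have -> : EFin \o (fun x => dot (b + lam x *: d) (phi x)) =
    ((EFin \o (fun x => dot (phi x) b)) \+
     (EFin \o (fun x => lam x * dot (phi x) d)%R))%E.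
    by apply/funext => x; rewrite /= dotDl dotZl EFinD !(dotC _ (phi x)).
  by apply: integrableD => //; exact: bounded_mul.
have uE : \int[mu]_(x in Omega) dot (u x) (phi x) =
    \int[mu]_(x in Omega) dot (b + lam x *: d) (phi x).
  rewrite /Rintegral; congr fine; apply: ae_eq_integral => //.
  - apply/measurable_EFinP; apply: measurable_sum => i; apply: measurable_funM.
      exact: (measurableT_comp (@measurable_rV_coord R m i) Lu.1).
    exact: (measurableT_comp (@measurable_rV_coord R m i) Lphi.1).
  - exact: measurable_int ilam.
  - by apply: filterS ulam => x H Ox; rewrite H.
have u_E j : \int[mu]_(x in Omega) dot (u_ j x) (phi x) =
    \int[mu]_(x in Omega) dot (u x) (phi x) +
    \int[mu]_(x in Omega) ((\1_(W j) x - lam x) * dot (phi x) d).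
  rewrite uE -RintegralD//; apply: eq_Rintegral => x _.
  by rewrite /u_ !dotDl !dotZl (dotC d); ring.
under eq_cvg do rewrite u_E.
have := cvgD (cvg_cst (\int[mu]_(x in Omega) dot (u x) (phi x))) (WP _ (iphi d)).
by rewrite addr0; apply.
Qed.

End weak_limits.

(** * Characterization of the weak closure *)

Theorem theorem1p1 (R : realType) (n m : nat) (n_gt0 : (0 < n)%N)
  (m_gt0 : (0 < m)%N) (Omega : set 'rV[R]_n)
  (K : set ('rV[R]_m * 'rV[R]_m))
  (Omega_neq0 : Omega !=set0) (Omega_bounded : bounded_set Omega)
  (Omega_open : open Omega) (K_compact : compact K)
  (hK : (1 < m)%N ->
    [/\ compact (sc_hull (symdiag K)),
        symdiag (sc_hull (symdiag K)) =
          \bigcup_(z in symdiag K) square z.1 z.2 &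
        maximal_cartesian_subsets (sc_hull (symdiag K)) `<=`
          [set square z.1 z.2 | z in symdiag K]]) :
  weak_star_seq_closure Omega (admissible Omega K) =
  admissible Omega (sc_hull (symdiag K)).
Proof.
have mO : measurable Omega by exact: open_measurable_rV.
have O0 := lebesgue_rV_open_gt0 Omega_open Omega_neq0.
have Ooo := lebesgue_rV_bounded_lty Omega_bounded mO.
have [cH HP] : compact (sc_hull (symdiag K)) /\
    forall A, A !=set0 -> closed A -> A `*` A `<=` sc_hull (symdiag K) ->
    exists2 z, symdiag K z & A `<=` segment z.1 z.2.
  by apply: sc_hull_compact_cartesian => // /hK[].
have clK : closed K by apply: compact_closed => //; exact: norm_hausdorff.
have clH : closed (sc_hull (symdiag K)).
  by apply: compact_closed => //; exact: norm_hausdorff.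
have KH A : A `*` A `<=` K -> A `*` A `<=` sc_hull (symdiag K).
  move=> AK [x y] [Ax Ay]; apply: (@sub_gen_smallest _ _ _); split; exact: AK.
apply/seteqP; split=> u.
- move=> [Lu [u_ [Au_ wu]]]; split=> //.
  have /choice[p_ p_P] : forall j, exists z, symdiag K z /\
      \forall x \ae lebesgue_rV R n, Omega x -> segment z.1 z.2 (u_ j x).
    move=> j; have [Lu_ u_K] := Au_ j.
    have [A [A0 clA AK uA]] := essential_range_cartesian mO O0 Lu_.1 clK u_K.
    have [z Kz Az] := HP A A0 clA (KH _ AK); exists z; split=> //.
    by apply: filterS uA => x H Ox; apply: Az; exact: H.
  have [[a b] [Kab clab]] : exists p, symdiag K p /\ cluster (p_ @ \oo) p.
    have pK : (p_ @ \oo) (symdiag K) by exists 0%N => // j _; have [] := p_P j.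
    have [p [Kp clp]] := symdiag_compact K_compact _ pK.
    by exists p.
  have uab := weak_limit_segment mO Ooo (fun j => (Au_ j).1) Lu
    (fun j => (p_P j).2) clab wu.
  apply: filterS (ae_product uab) => z [H1 H2] [Oz1 Oz2].
  by apply: (square_sub_sc_hull Kab); split; [exact: H1|exact: H2].
- move=> [Lu uH].
  have [A [A0 clA AH uA]] := essential_range_cartesian mO O0 Lu.1 clH uH.
  have [[a b] [Kab Kaa Kba Kbb] /= Aab] := HP A A0 clA AH.
  have uab : \forall x \ae lebesgue_rV R n, Omega x -> segment a b (u x).
    by apply: filterS uA => x H Ox; apply: Aab; exact: H.
  have [u_ [Lu_ u_ab wu]] := segment_weak_limit mO Ooo n_gt0 Omega_bounded Lu uab.
  split=> //; exists u_; split=> // j; split=> //.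
  apply: aeW => z _.
  by case: (u_ab j z.1) => ->; case: (u_ab j z.2) => ->.
Qed.
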